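(* Let $d \ge 1$ be an integer and let $1 \leq r,q \leq \infty$ be such that $$\frac{d}{q} + \frac{2}{r} > 1 .$$ Then there exist a velocity field $b \in L^r([0,1);L^q(\mathbb{R}^d;\mathbb{R}^d)) \cap C^\infty([0,1)\times\mathbb{R}^d;\mathbb{R}^d)$, an initial datum $u_0 \in C^\infty_c(\mathbb{R}^d)$, and a solution $u \in C^\infty([0,1)\times\mathbb{R}^d)$ of the Cauchy problem $$\partial_t u + \operatorname{div}(bu) = \Delta u \ \text{ in } [0,1)\times\mathbb{R}^d, \qquad u(0,\cdot)=u_0,$$ which has no uniform in time integrability bounds better than in $L^1(\mathbb{R}^d)$, or equivalently, such that $u$ is not uniformly in time equi-integrable on $\mathbb{R}^d$ (that is, the family $\{u(t,\cdot)\}_{0\le t<1}$ is not equi-integrable). In particular, for any $1 < p \leq \infty$, $$\lim_{t \to 1^-} \| u(t,\cdot) \|_{L^p(\mathbb{R}^d)} = \infty .$$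
   Context: Here $b=b(t,x)$ is $\mathbb{R}^d$-valued and $u=u(t,x)$ is real-valued; $\operatorname{div}$ and $\Delta$ act on the space variable $x\in\mathbb{R}^d$ only. The convention $1/\infty=0$ is used. $L^r([0,1);L^q(\mathbb{R}^d))$ is the space of measurable functions on $[0,1)\times\mathbb{R}^d$ for which $t\mapsto\|b(t,\cdot)\|_{L^q(\mathbb{R}^d)}$ belongs to $L^r([0,1))$. A family $\{f_i\}_{i\in I}$ of functions on $\mathbb{R}^d$ is called equi-integrable if for every $\varepsilon>0$ there is $\delta>0$ such that $\int_A |f_i|\,dx\le\varepsilon$ for all $i\in I$ and all Borel sets $A\subset\mathbb{R}^d$ of Lebesgue measure less than $\delta$. The phrase ''no uniform in time integrability bounds better than in $L^1$'' is understood as the failure of equi-integrability of $\{u(t,\cdot)\}_{0\le t<1}$. *)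

(* Defs.v *)
From HB Require Import structures.
From mathcomp Require Import all_boot all_order all_algebra.
From mathcomp Require Import all_classical all_reals all_analysis.
From mathcomp Require Import measurable_realfun.

Set Implicit Arguments.
Unset Strict Implicit.
Unset Printing Implicit Defensive.

Import Order.TTheory GRing.Theory Num.Theory.
Import numFieldNormedType.Exports.

Local Open Scope classical_set_scope.
Local Open Scope ring_scope.

Section borel_matrix.
Context (R : realType) (m n : nat).

Let borel : set (set 'M[R]_(m, n)) := <<s [set U | open U] >>.

Let borel0 : borel set0.
Proof. exact: sigma_algebra0. Qed.

Let borelC A : borel A -> borel (~` A).
Proof. exact: sigma_algebraC. Qed.

Let borel_bigcup (F : (set 'M[R]_(m, n))^nat) :
  (forall i, borel (F i)) -> borel (\bigcup_i F i).
Proof. exact: sigma_algebra_bigcup. Qed.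

HB.instance Definition _ := @isMeasurable.Build default_measure_display
  'M[R]_(m, n) borel borel0 borelC borel_bigcup.

End borel_matrix.

Section borel_rV.
Context (R : realType).

Lemma open_measurable_mx m n (U : set 'M[R]_(m, n)) : open U -> measurable U.
Proof. by move=> oU; exact: sub_sigma_algebra. Qed.

Lemma measurable_coord n (i : 'I_n) :
  measurable_fun [set: 'rV[R]_n] (fun v => v ord0 i : measurableTypeR R).
Proof.
apply: (measurability _ (RGenOpens.measurableE R)) => _ [_ [a [b ->]] <-].
rewrite setTI; apply: open_measurable_mx; apply: open_comp.
  by move=> x _; exact: coord_continuous.
exact: interval_open.
Qed.

Lemma measurable_fun_rV d (T : measurableType d) n (f : T -> 'rV[R]_n) :
  (forall i, measurable_fun [set: T] (fun x => f x ord0 i : measurableTypeR R)) ->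
  measurable_fun [set: T] f.
Proof.
move=> mf.
apply: (@measurability _ _ _ 'rV[R]_n setT f [set U | open U]) => //.
move=> _ [U /= oU <-]; rewrite setTI.
pose box (q : 'rV[rat]_n * nat) : set 'rV[R]_n :=
  [set v | forall i, `|ratr (q.1 ord0 i) - v ord0 i| < q.2.+1%:R^-1].
have -> : f @^-1` U =
    \bigcup_q (if `[< box q `<=` U >] then f @^-1` box q else set0).
  apply/seteqP; split=> x /=; last first.
    by case=> q _; case: ifPn => // /asboolP bU /= /bU.
  move=> Ufx.
  have /nbhs_ballP[e /= e0 eU] : nbhs (f x) U by exact: open_nbhs_nbhs.
  have [k ke] : exists k : nat, k.+1%:R^-1 < e / 2.
    have e20 : 0 < e / 2 by rewrite divr_gt0.
    have [k _ /(_ k (leqnn _)) h] := near_infty_natSinv_lt (PosNum e20).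
    by exists k.
  have rq i : exists q : rat, `|ratr q - f x ord0 i| < k.+1%:R^-1.
    have [|q] := @rat_in_itvoo R (f x ord0 i - k.+1%:R^-1) (f x ord0 i + k.+1%:R^-1).
      by rewrite ltrBlDr -addrA ltrDl addr_gt0 ?invr_gt0.
    by rewrite in_itv/= => qi; exists q; rewrite ltr_distl.
  have [g gP] := choice rq.
  exists (\row_i g i, k) => //.
  rewrite ifT; first by move=> i /=; rewrite mxE.
  apply/asboolP => v /= bv; apply: eU; split=> // i j.
  rewrite (ord1 i); apply: (@le_lt_trans _ _ (`|f x ord0 j - ratr (g j)| +
    `|ratr (g j) - v ord0 j|)).
    by rewrite (le_trans _ (ler_normD _ _))// addrA subrK.
  rewrite (splitr e) ltrD//.
    by rewrite distrC (lt_trans (gP j)).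
  by move: (bv j); rewrite mxE => /lt_trans; apply.
apply: countable_bigcupT_measurable; first exact: countableP.
move=> q; case: ifPn => // _.
rewrite (_ : f @^-1` box q = \bigcap_(i in [set: 'I_n])
    ((fun x => f x ord0 i) @^-1` ball (ratr (q.1 ord0 i) : R) q.2.+1%:R^-1)).
  apply: fin_bigcap_measurable; first exact: finite_finset.
  move=> i _; rewrite -[X in measurable X]setTI; apply: mf => //.
  exact: measurable_ball.
apply/seteqP; split=> x /= h i; first by move=> _; exact: h.
exact: (h i I).
Qed.


Definition cons_rV n (p : measurableTypeR R * 'rV[R]_n) : 'rV[R]_n.+1 :=
  \row_i (if unlift ord0 i is Some j then p.2 ord0 j else p.1).

Definition uncons_rV n (v : 'rV[R]_n.+1) : measurableTypeR R * 'rV[R]_n :=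
  (v ord0 ord0, \row_j v ord0 (lift ord0 j)).

Lemma cons_rVK n : cancel (@cons_rV n) (@uncons_rV n).
Proof.
move=> [a v]; rewrite /uncons_rV mxE unlift_none; congr pair.
by apply/rowP => j; rewrite !mxE liftK.
Qed.

Lemma measurable_cons_rV n : measurable_fun setT (@cons_rV n).
Proof.
apply: measurable_fun_rV => i.
case: (unliftP ord0 i) => [j|] ->.
  rewrite [X in measurable_fun _ X](_ : _ =
      (fun v : 'rV[R]_n => v ord0 j : measurableTypeR R) \o snd); last first.
    by apply/funext => x /=; rewrite mxE liftK.
  by apply: measurableT_comp => //; exact: measurable_coord.
rewrite [X in measurable_fun _ X](_ : _ = fst)//.
by apply/funext => x /=; rewrite mxE unlift_none.
Qed.

Lemma measurable_uncons_rV n : measurable_fun setT (@uncons_rV n).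
Proof.
apply/measurable_fun_pairP; split => /=; first exact: measurable_coord.
apply: measurable_fun_rV => i /=.
rewrite [X in measurable_fun _ X](_ : _ =
    (fun v : 'rV[R]_n.+1 => v ord0 (lift ord0 i))).
  exact: measurable_coord.
by apply/funext => x /=; rewrite mxE.
Qed.

Section step.
Context n (mu : {sigma_finite_measure set 'rV[R]_n -> \bar R}).

Definition lebesgue_rVS : set 'rV[R]_n.+1 -> \bar R :=
  pushforward (lebesgue_measure \x mu)%E (@cons_rV n).

Let measurable_cons_preimage (A : set 'rV[R]_n.+1) :
  measurable A -> measurable (@cons_rV n @^-1` A).
Proof.
by move=> mA; rewrite -[X in measurable X]setTI; exact: measurable_cons_rV.
Qed.

Let lebesgue_rVS0 : lebesgue_rVS set0 = 0%E.
Proof. by rewrite /lebesgue_rVS /pushforward preimage_set0 measure0. Qed.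

Let lebesgue_rVS_ge0 A : (0 <= lebesgue_rVS A)%E.
Proof. by rewrite /lebesgue_rVS /pushforward; exact: measure_ge0. Qed.

Let lebesgue_rVS_sigma_additive : semi_sigma_additive lebesgue_rVS.
Proof.
move=> F mF tF mUF; rewrite /lebesgue_rVS /pushforward preimage_bigcup.
apply: measure_semi_sigma_additive.
- by move=> k; exact: measurable_cons_preimage.
- apply/trivIsetP => /= i j _ _ ij; rewrite -preimage_setI.
  by move/trivIsetP : tF => /(_ _ _ _ _ ij) ->//; rewrite preimage_set0.
- by rewrite -preimage_bigcup; exact: measurable_cons_preimage.
Qed.

HB.instance Definition _ := isMeasure.Build _ _ _ lebesgue_rVS
  lebesgue_rVS0 lebesgue_rVS_ge0 lebesgue_rVS_sigma_additive.

Let lebesgue_rVS_sigma_finite : sigma_finite setT lebesgue_rVS.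
Proof.
have /sigma_finiteP[F [FT ndF Foo]] := sigma_finiteT (@lebesgue_measure R).
have /sigma_finiteP[G [GT ndG Goo]] := sigma_finiteT mu.
exists (fun i => @uncons_rV n @^-1` (F i `*` G i)).
  rewrite -preimage_bigcup; apply/seteqP; split=> // v _.
  have : [set: measurableTypeR R] (uncons_rV v).1 by [].
  have : [set: 'rV[R]_n] (uncons_rV v).2 by [].
  rewrite FT GT => -[k _ Gk] [j _ Fj]; exists (maxn j k) => //; split.
    by move: (Fj); exact/subsetPset/ndF/leq_maxl.
  by move: (Gk); exact/subsetPset/ndG/leq_maxr.
move=> i; have [mF Fi] := Foo i; have [mG Gi] := Goo i; split.
  rewrite -[X in measurable X]setTI; apply: measurable_uncons_rV => //.
  exact: measurableX.
rewrite /lebesgue_rVS /pushforward -comp_preimage (_ : _ \o _ = id); last first.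
  by apply/funext => x /=; rewrite cons_rVK.
by rewrite preimage_id product_measure1E// lte_mul_pinfty// ge0_fin_numE.
Qed.

HB.instance Definition _ := Measure_isSigmaFinite.Build _ _ _ lebesgue_rVS
  lebesgue_rVS_sigma_finite.

End step.

Fixpoint lebesgue_rV n : {sigma_finite_measure set 'rV[R]_n -> \bar R} :=
  if n is n'.+1 then lebesgue_rVS (lebesgue_rV n') else \d_(0 : 'rV[R]_0).


Lemma lebesgue_rV_box n (A : 'I_n -> set (measurableTypeR R)) :
  (forall i, measurable (A i)) ->
  lebesgue_rV n [set v | forall i, A i (v ord0 i)] =
  (\prod_(i < n) lebesgue_measure (A i))%E.
Proof.
elim: n A => [|n IH] A mA /=.
  by rewrite big_ord0 diracE mem_set// => -[].
rewrite big_ord_recl -(IH (fun i => A (lift ord0 i)))//.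
rewrite -product_measure1E//; last first.
  rewrite [X in measurable X](_ : _ = \bigcap_(i in [set: 'I_n])
    ((fun v : 'rV[R]_n => v ord0 i : measurableTypeR R) @^-1` A (lift ord0 i))).
    apply: fin_bigcap_measurable => [|i _]; first exact: finite_finset.
    by rewrite -[X in measurable X]setTI; exact: measurable_coord.
  by apply/seteqP; split=> v /= h i; [move=> _|]; exact: h.
rewrite /lebesgue_rVS /pushforward; congr (_ _).
apply/seteqP; split=> -[a v] /=.
  move=> h; split => [|i]; first by have := h ord0; rewrite mxE unlift_none.
  by have := h (lift ord0 i); rewrite mxE liftK.
by move=> [h0 h] i; rewrite mxE; case: (unliftP ord0 i) => [j|] ->; [exact: h|].
Qed.

End borel_rV.

Section smooth.
Context (R : realType) (V W : normedModType R).

Definition difference_quotient (f : V -> W) (v x : V) (h : R) : W :=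
  h^-1 *: (f (h *: v + x) - f x).

(* The increment h is restricted to those for which h v + x stays in A, so
   that derivatives are one-sided where the boundary of A demands it, and the
   values of f outside A are irrelevant. *)
Definition increments (A : set V) (v x : V) : set_system R :=
  within [set h | A (h *: v + x)] (0 : R)^'.

Definition derivable_within (A : set V) (f : V -> W) (x v : V) : Prop :=
  cvg (difference_quotient f v x @ increments A v x).

Definition derive_within (A : set V) (f : V -> W) (v x : V) : W :=
  lim (difference_quotient f v x @ increments A v x).

Fixpoint iter_derive_within (A : set V) (f : V -> W) (s : seq V) : V -> W :=
  if s is v :: s' then derive_within A (iter_derive_within A f s') v else f.

(* C^oo(A): the iterated directional derivatives of all orders exist and are
   continuous on A. The intended A are open sets and [0, 1) x R^d. *)
Definition smooth_on (A : set V) (f : V -> W) : Prop :=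
  forall s : seq V,
    {within A, continuous (iter_derive_within A f s)} /\
    forall x v, A x -> derivable_within A (iter_derive_within A f s) x v.

Lemma increments_setT (v x : V) : increments setT v x = (0 : R)^'.
Proof.
rewrite /increments; apply/seteqP; split=> P FP.
  have : \forall h \near (0 : R)^', setT (h *: v + x) -> P h by exact: FP.
  by apply: filterS => h /(_ I).
have : \forall h \near (0 : R)^', P h by exact: FP.
by apply: filterS => h Ph _.
Qed.

Lemma derivable_within_setT (f : V -> W) (x v : V) :
  derivable_within setT f x v = derivable f x v.
Proof. by rewrite /derivable_within increments_setT. Qed.

Lemma derive_within_setT (f : V -> W) (v : V) :
  derive_within setT f v = 'D_v f.
Proof. by apply/funext => x; rewrite /derive_within increments_setT. Qed.

End smooth.

Section pde.
Context (R : realType) (d : nat).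
Implicit Types (b : R -> 'rV[R]_d -> 'rV[R]_d) (u : R -> 'rV[R]_d -> R).

Definition partial (i : 'I_d) (g : 'rV[R]_d -> R) : 'rV[R]_d -> R :=
  'D_(delta_mx ord0 i) g.

Definition div (F : 'rV[R]_d -> 'rV[R]_d) (x : 'rV[R]_d) : R :=
  \sum_i partial i (fun y => F y ord0 i) x.

Definition laplacian (g : 'rV[R]_d -> R) (x : 'rV[R]_d) : R :=
  \sum_i partial i (partial i g) x.

Definition time_space : set (R * 'rV[R]_d) := `[0, 1[ `*` setT.

Definition smooth_compact_support (g : 'rV[R]_d -> R) : Prop :=
  smooth_on setT g /\ compact (closure [set x | g x != 0]).

Definition cauchy_problem b u (u0 : 'rV[R]_d -> R) : Prop :=
  (forall (t : R) (x : 'rV[R]_d), 0 <= t < 1 ->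
     derive_within (`[0, 1[ : set R) (u ^~ x) 1 t
       + div (fun y => u t y *: b t y) x = laplacian (u t) x) /\
  u 0 = u0.

End pde.

Section integrability.
Context (R : realType) (d : nat).
Local Open Scope ereal_scope.

Definition norm2 (v : 'rV[R]_d) : R := Num.sqrt (\sum_i v ord0 i ^+ 2)%R.

Definition Lq_norm (q : \bar R) (F : 'rV[R]_d -> 'rV[R]_d) : \bar R :=
  Lnorm (lebesgue_rV R d) q (fun x => (norm2 (F x))%:E).

Definition lebesgue01 : set (measurableTypeR R) -> \bar R :=
  mrestr lebesgue_measure (measurable_itv `[0%R, 1%R[).

(* L^r([0, 1); L^q(R^d; R^d)) *)
Definition in_LrLq (r q : \bar R) (b : R -> 'rV[R]_d -> 'rV[R]_d) : Prop :=
  [/\ measurable_fun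
        (@time_space R d : set (measurableTypeR R * 'rV[R]_d))
        (fun z : measurableTypeR R * 'rV[R]_d => b z.1 z.2),
      measurable_fun (`[0%R, 1%R[ : set (measurableTypeR R))
        (fun t : measurableTypeR R => Lq_norm q (b t))
    & Lnorm lebesgue01 r (fun t : measurableTypeR R => Lq_norm q (b t)) < +oo].

Definition equi_integrable (I : Type) (J : set I) (f : I -> 'rV[R]_d -> R) :
    Prop :=
  forall e : R, (0 < e)%R -> exists2 delta : R, (0 < delta)%R &
    forall i (A : set 'rV[R]_d), J i -> measurable A ->
      lebesgue_rV R d A < delta%:E ->
      \int[lebesgue_rV R d]_(x in A) `|f i x|%:E <= e%:E.

End integrability.

(* Main.v *)
Require Import Defs.
From mathcomp Require Import all_boot all_order all_algebra.
From mathcomp Require Import all_classical all_reals all_analysis.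
From mathcomp Require Import ring lra measurable_realfun ess_sup_inf.

Set Implicit Arguments.
Unset Strict Implicit.
Unset Printing Implicit Defensive.

Import Order.TTheory GRing.Theory Num.Theory.
Import numFieldNormedType.Exports.

Local Open Scope classical_set_scope.
Local Open Scope ring_scope.

(** The solution is the sum of two explicit densities. The first one, background,
is the heat evolution of a bump; it solves the equation without drift and is
bounded below by a positive constant on the unit cube, uniformly for t in
[0, 1]. The second one, spike, is the self-similar density
lam^d Psi (lam x) with lam = (1 - t)^(-1/2); its mass does not depend on t and
concentrates at the origin as t tends to 1. The spike does not solve the heat
equation, but it is transported by the linear field -(lam'/lam) x =
-(lam^2/2) x, so that its defect (laplacian minus time derivative) is the
divergence of
<<
   N = grad spike - (lam^2/2) x spike,
>>
which lives on the cube where |x_i| <= 1/lam. Hence u = background + spike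
solves the equation with the drift b = N / u. Since u vanishes far away at
t = 0, where the background is still compactly supported, a function that
is zero on the unit cube and positive outside (wall) is added to the
denominator; it leaves b unchanged and makes it smooth (density_cauchy,
drift_smooth, initial_smooth_compact_support).

By scaling, N / spike would be of size lam, but it is unbounded near the edge of
the support of Psi. The background prevents this. Psi is chosen as X^(m+1) with X
a product of bump functions, so that N is at most C lam^(d+1) X^m, and
<<
   |b| <= C lam^(d+1) X^m / (1 + lam^d X^(m+1)) <= C lam^(1 + d/(m+1))
>>
(drift_le). The norm of b in L^q is therefore at most C lam^(1 + d/(m+1) - d/q),
and lam = (1 - t)^(-1/2) to that power belongs to L^r (0, 1) when
1 + d/(m+1) < d/q + 2/r. By the assumption on r and q this is true for m large
(drift_in_LrLq).

The spike is at least (k lam)^d on a cube of volume lam^-d. The integral of u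
over this cube stays above k^d while the volume tends to 0, and the L^p norm is
at least k^d lam^(d (1 - 1/p)) (density_not_equi_integrable,
density_Lnorm_cvgy).

Both densities are tensor products of functions of one space variable, which
reduces the equation to one dimension. The one-dimensional heat evolution is
the Gaussian average of phi (x + 2 sqrt t y) in y. Its derivatives are heat
evolutions of derivatives of phi, with explicit remainders that hold up to
t = 0 (heat_taylor), and this gives smoothness on [0, 1) x R^d. Smoothness of
everything else is obtained from closure properties of the classes Ck. *)

(** * Derivatives along increments *)

Section directional_derivatives.
Context (R : realType) (V W : normedModType R).
Implicit Types (A : set V) (f g : V -> W) (v x : V).

(** Carrying the limit l explicitly avoids uniqueness of limits in the rules
below: uniqueness holds only where the increments accumulate at 0. *)
Definition has_derive_within A f v x (l : W) : Prop :=
  difference_quotient f v x @ increments A v x --> l.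

#[global] Instance increments_filter A v x : Filter (increments A v x).
Proof. exact: within_filter. Qed.

Lemma increments_neq0 A v x : \forall h \near increments A v x, h != 0.
Proof. exact: filterS (nbhs_dnbhs_neq (0 : R)). Qed.

Lemma increments_in A v x : \forall h \near increments A v x, A (h *: v + x).
Proof. by rewrite /increments near_withinE; exact: nearW. Qed.

Lemma increments_cvg0 A v x : h @[h --> increments A v x] --> (0 : R).
Proof. by apply: cvg_within_filter; apply: nbhs_dnbhs. Qed.

Lemma eq_has_derive_within A f g v x l : A x -> {in A, f =1 g} ->
  has_derive_within A f v x l -> has_derive_within A g v x l.
Proof.
move=> Ax fg; apply: cvg_trans; apply: near_eq_cvg.
near=> h; rewrite /difference_quotient !fg ?inE//.
by near: h; exact: increments_in.
Unshelve. all: by end_near. Qed.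

Lemma has_derive_within_cst A (c : W) v x :
  has_derive_within A (cst c) v x 0.
Proof.
rewrite /has_derive_within (_ : difference_quotient _ _ _ = cst 0).
  exact: cvg_cst.
by apply/funext => h; rewrite /difference_quotient subrr scaler0.
Qed.

Lemma has_derive_withinD A f g v x l m :
  has_derive_within A f v x l -> has_derive_within A g v x m ->
  has_derive_within A (f \+ g) v x (l + m).
Proof.
move=> fl gm; rewrite /has_derive_within.
rewrite (_ : difference_quotient _ _ _ =
   difference_quotient f v x \+ difference_quotient g v x).
  exact: cvgD.
by apply/funext => h; rewrite /difference_quotient /= -scalerDr addrACA -opprD.
Qed.

Lemma has_derive_within_cvg A f v x l : has_derive_within A f v x l ->
  f (h *: v + x) @[h --> increments A v x] --> f x.
Proof.
move=> fl; have : h *: difference_quotient f v x h + f x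
    @[h --> increments A v x] --> (0 : R) *: l + f x.
  apply: cvgD; last exact: cvg_cst.
  apply: cvgZ fl; exact: increments_cvg0.
rewrite scale0r add0r; apply: cvg_trans; apply: near_eq_cvg.
near=> h; rewrite /difference_quotient scalerA mulfV; last first.
  by near: h; exact: increments_neq0.
by rewrite scale1r subrK.
Unshelve. all: by end_near. Qed.

Lemma has_derive_within_lin A f v x :
  (forall h y z, f (h *: y + z) = h *: f y + f z) ->
  has_derive_within A f v x (f v).
Proof.
move=> fL; have : cst (f v) @ increments A v x --> f v by exact: cvg_cst.
apply: cvg_trans; apply: near_eq_cvg.
near=> h; rewrite /difference_quotient fL addrK scalerA mulVf ?scale1r//.
by near: h; exact: increments_neq0.
Unshelve. all: by end_near. Qed.

End directional_derivatives.

Section scalar_rules.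
Context (R : realType) (V : normedModType R).
Implicit Types (A : set V) (f g : V -> R) (v x : V).

Lemma has_derive_withinZ (W : normedModType R) A f (w : W) v x l :
  has_derive_within A f v x l ->
  has_derive_within A (fun x => f x *: w) v x (l *: w).
Proof.
move=> fl; rewrite /has_derive_within.
rewrite (_ : difference_quotient _ _ _ =
   fun h => difference_quotient f v x h *: w).
  exact: cvgZr_tmp.
by apply/funext => h; rewrite /difference_quotient -scalerBl scalerA.
Qed.

Lemma has_derive_withinM A f g v x l m :
  has_derive_within A f v x l -> has_derive_within A g v x m ->
  has_derive_within A (fun x => f x * g x) v x (l * g x + f x * m).
Proof.
move=> fl gm; rewrite /has_derive_within.
rewrite (_ : difference_quotient _ _ _ = fun h =>
   difference_quotient f v x h * g (h *: v + x) +
   f x * difference_quotient g v x h).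
  apply: cvgD; first by apply: cvgM => //; exact: has_derive_within_cvg gm.
  by apply: cvgM => //; exact: cvg_cst.
apply/funext => h; rewrite /difference_quotient /GRing.scale /=.
ring.
Qed.

Lemma has_derive_within_prod (I : eqType) (s : seq I) A (F : I -> V -> R)
    (l : I -> R) v x : uniq s ->
  (forall i, has_derive_within A (F i) v x (l i)) ->
  has_derive_within A (fun x => \prod_(i <- s) F i x) v x
    (\sum_(i <- s) l i * \prod_(j <- s | j != i) F j x).
Proof.
move=> + Fl; elim: s => [_|i s IH /= /andP[si us]].
  rewrite big_nil; under eq_fun do rewrite big_nil.
  exact: has_derive_within_cst.
under eq_fun do rewrite big_cons.
rewrite big_cons big_cons eqxx /=.
have -> : \prod_(j <- s | j != i) F j x = \prod_(j <- s) F j x.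
  rewrite [LHS]big_seq_cond [RHS]big_seq; apply: eq_bigl => j.
  by case: (boolP (j \in s)) => //= js; apply: contraNneq si => <-.
have -> : \sum_(j <- s) l j * \prod_(k <- i :: s | k != j) F k x =
    F i x * \sum_(j <- s) l j * \prod_(k <- s | k != j) F k x.
  rewrite mulr_sumr big_seq [RHS]big_seq; apply: eq_bigr => j js.
  rewrite big_cons ifT 1?mulrCA//.
  by apply: contraNneq si => ->.
exact: has_derive_withinM (IH us).
Qed.

End scalar_rules.

Lemma is_derive_withinT (R : realType) (V W : normedModType R) (f : V -> W)
    v x l : is_derive x v f l <-> has_derive_within setT f v x l.
Proof.
rewrite /has_derive_within increments_setT; split => [[fd <-]|fl].
  by apply: cvg_trans fd; apply: cvg_refl.
by split; [apply/cvg_ex; exists l | exact/cvg_lim].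
Qed.

(** The difference quotient of G at f x is extended by G'(f x) at increment
0, since f may take the value f x arbitrarily close to x. *)
Lemma has_derive_within_comp (R : realType) (V : normedModType R)
    (A : set V) (f : V -> R) (G : R -> R) v x l m :
  is_derive (f x) 1 G m -> has_derive_within A f v x l ->
  has_derive_within A (G \o f) v x (m * l).
Proof.
move=> /is_derive_withinT; rewrite /has_derive_within increments_setT => Gm fl.
pose r k := if k == 0 then m else difference_quotient G 1 (f x) k.
have r0 : r 0 = m by rewrite /r eqxx.
have rm : r k @[k --> 0] --> m.
  rewrite -r0; apply/continuous_withinNx; rewrite r0.
  apply: cvg_trans Gm; apply: near_eq_cvg; near=> k.
  by rewrite /r ifF//; apply/negbTE; near: k; exact: nbhs_dnbhs_neq.
have fx0 : f (h *: v + x) - f x @[h --> increments A v x] --> (0 : R).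
  by rewrite -(subrr (f x)); apply: cvgB (cvg_cst _); exact: has_derive_within_cvg fl.
have rf : r (f (h *: v + x) - f x) @[h --> increments A v x] --> m.
  exact: cvg_comp fx0 rm.
rewrite (_ : difference_quotient _ _ _ = fun h =>
   r (f (h *: v + x) - f x) * difference_quotient f v x h).
  exact: cvgM.
apply/funext => h; rewrite /difference_quotient /r /=.
case: eqP => [/eqP|/eqP k0].
  by rewrite subr_eq0 => /eqP ->; rewrite !subrr !scaler0 mulr0.
rewrite /difference_quotient /GRing.scale /= mulr1 subrK.
by rewrite [RHS]mulrC -mulrA mulVKf.
Unshelve. all: by end_near. Qed.

(** * Continuous differentiability on a set *)

Section continuously_differentiable.
Context (R : realType) (V : normedModType R).

(** Membership in C^n is stated by recursion on n, with the derivatives given by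
existential witnesses: algebraic closure properties then follow by induction
on n from the rules of calculus, whereas iterated derivatives taken as limits
would have to be computed first. *)
Fixpoint Ck (W : normedModType R) (A : set V) (n : nat) (f : V -> W) : Prop :=
  {within A, continuous f} /\
  if n is n'.+1 then forall v, exists2 g, Ck A n' g &
    forall x, A x -> has_derive_within A f v x (g x)
  else True.

Section any_codomain.
Context (W : normedModType R).
Implicit Types (A : set V) (f g : V -> W).

Lemma Ck_continuous A n f : Ck A n f -> {within A, continuous f}.
Proof. by case: n => [|n] []. Qed.

Lemma CkW A n f : Ck A n.+1 f -> Ck A n f.
Proof.
elim: n f => [|n IH] f [fc fd]; split=> // v.
by have [g gC fg] := fd v; exists g => //; exact: IH.
Qed.

Lemma Ck_cst A n (c : W) : Ck A n (cst c).
Proof.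
have cc : {within A, continuous (cst c : V -> W)}.
  by apply: continuous_subspaceT => x; exact: cvg_cst.
elim: n c cc => [|n IH] c cc; split=> // v; exists (cst 0).
  by apply: IH; apply: continuous_subspaceT => x; exact: cvg_cst.
by move=> x _; exact: has_derive_within_cst.
Qed.

Lemma Ck_linear A n f : continuous f ->
  (forall h y z, f (h *: y + z) = h *: f y + f z) -> Ck A n f.
Proof.
move=> fc fL; case: n => [|n]; split=> //; try exact: continuous_subspaceT.
move=> v; exists (cst (f v)); first exact: Ck_cst.
by move=> x _; exact: has_derive_within_lin.
Qed.

Lemma continuous_within_add A f g : {within A, continuous f} ->
  {within A, continuous g} -> {within A, continuous (f \+ g)}.
Proof. by move=> fc gc x; apply: cvgD; [exact: fc|exact: gc]. Qed.

Lemma CkD A n f g : Ck A n f -> Ck A n g -> Ck A n (f \+ g).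
Proof.
elim: n f g => [|n IH] f g [fc fd] [gc gd]; split=> //;
  try exact: continuous_within_add.
move=> v; have [f' Cf' ff'] := fd v; have [g' Cg' gg'] := gd v.
exists (f' \+ g'); first exact: IH.
by move=> x Ax; apply: has_derive_withinD; [exact: ff'|exact: gg'].
Qed.

Lemma Ck_sum A n (I : Type) (s : seq I) (F : I -> V -> W) :
  (forall i, Ck A n (F i)) -> Ck A n (fun x => \sum_(i <- s) F i x).
Proof.
move=> FC; elim: s => [|i s IH].
  by under eq_fun do rewrite big_nil; exact: Ck_cst.
by under eq_fun do rewrite big_cons; exact: CkD.
Qed.

(** The limits along increments are unique as soon as the increments that
stay in A accumulate at 0. *)
Lemma Ck_smooth_on A f :
  (forall v x, A x -> ProperFilter (increments A v x)) ->
  (forall n, Ck A n f) -> smooth_on A f.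
Proof.
move=> Apf fC.
have key s n : exists2 g, Ck A n g & {in A, iter_derive_within A f s =1 g}.
  elim: s n => [|v s IH] n; first by exists f.
  have [g [_ gd] fg] := IH n.+1; have [g' Cg' gg'] := gd v.
  exists g' => // x /[!inE] Ax /=; apply/cvg_lim => //.
    exact: Apf.
  apply: eq_has_derive_within (gg' x Ax) => // y Ay.
  by symmetry; exact: fg.
move=> s; split.
  have [g Cg fg] := key s 0.
  have /subspace_continuousP gc := Ck_continuous Cg.
  apply/subspace_continuousP => x Ax.
  rewrite /from_subspace; have -> : iter_derive_within A f s x = g x by apply: fg; rewrite inE.
  apply: cvg_trans (gc x Ax); apply: near_eq_cvg.
  by rewrite near_withinE; apply: nearW => y Ay; apply/esym/fg; rewrite inE.
move=> x v Ax; have [g [_ gd] fg] := key s 1; have [g' _ gg'] := gd v.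
apply/cvg_ex; exists (g' x).
by apply: eq_has_derive_within (gg' x Ax) => // y Ay; exact: esym (fg y Ay).
Qed.

End any_codomain.

Section scalar_valued.
Implicit Types (A : set V) (f g : V -> R).

Lemma CkZ (W : normedModType R) A n f (w : W) :
  Ck A n f -> Ck A n (fun x => f x *: w).
Proof.
elim: n f => [|n IH] f [fc fd]; split=> //.
- by move=> x; apply: cvgZr_tmp; exact: fc.
- by move=> x; apply: cvgZr_tmp; exact: fc.
move=> v; have [f' Cf' ff'] := fd v; exists (fun x => f' x *: w).
  exact: IH.
by move=> x Ax; apply: has_derive_withinZ; exact: ff'.
Qed.

Lemma CkM A n f g : Ck A n f -> Ck A n g -> Ck A n (fun x => f x * g x).
Proof.
elim: n f g => [|n IH] f g fC gC.
  split=> // x.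
  by apply: cvgM; [exact: (Ck_continuous fC)|exact: (Ck_continuous gC)].
have [[fc fd] [gc gd]] := (fC, gC); split.
  by move=> x; apply: cvgM; [exact: fc|exact: gc].
move=> v; have [f' Cf' ff'] := fd v; have [g' Cg' gg'] := gd v.
exists (fun x => f' x * g x + f x * g' x).
  by apply: CkD; apply: IH => //; exact: CkW.
by move=> x Ax; apply: has_derive_withinM; [exact: ff'|exact: gg'].
Qed.

Lemma CkN A n f : Ck A n f -> Ck A n (fun x => - f x).
Proof.
move=> fC; rewrite (_ : (fun x => - f x) = fun x => cst (-1) x * f x).
  by apply: CkM => //; exact: Ck_cst.
by apply/funext => x; rewrite mulN1r.
Qed.

Lemma CkB A n f g : Ck A n f -> Ck A n g -> Ck A n (fun x => f x - g x).
Proof. by move=> fC gC; apply: CkD => //; exact: CkN. Qed.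

Lemma Ck_prod A n (I : Type) (s : seq I) (P : pred I) (F : I -> V -> R) :
  (forall i, Ck A n (F i)) -> Ck A n (fun x => \prod_(i <- s | P i) F i x).
Proof.
move=> FC; elim: s => [|i s IH].
  by under eq_fun do rewrite big_nil; exact: Ck_cst.
under eq_fun do rewrite big_cons.
by case: (P i) => //; exact: CkM.
Qed.

Lemma CkX A n f k : Ck A n f -> Ck A n (fun x => f x ^+ k).
Proof.
move=> fC; elim: k => [|k IH].
  by under eq_fun do rewrite expr0; exact: Ck_cst.
by under eq_fun do rewrite exprS; exact: CkM.
Qed.

Lemma continuous_within_comp A f (G G' : R -> R) :
  (forall x, A x -> is_derive (f x) 1 G (G' (f x))) ->
  {within A, continuous f} -> {within A, continuous (G \o f)}.
Proof.
move=> Gd /subspace_continuousP fc; apply/subspace_continuousP => x Ax.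
have [Gx _] := Gd x Ax.
have /derivable1_diffP/differentiable_continuous Gc := Gx.
exact: cvg_comp (fc x Ax) Gc.
Qed.

(** A family of functions of one variable that is stable under derivation up
to algebraic operations is handled by induction on the order: the derivative
of the composite has the same form, one order lower. *)
Lemma Ck_compS A n f (G G' : R -> R) :
  (forall x, A x -> is_derive (f x) 1 G (G' (f x))) ->
  Ck A n.+1 f -> Ck A n (G' \o f) -> Ck A n.+1 (G \o f).
Proof.
move=> Gd fC G'C; have [fc fd] := fC; split.
  exact: continuous_within_comp fc.
move=> v; have [f' Cf' ff'] := fd v.
exists (fun x => (G' \o f) x * f' x); first exact: CkM.
by move=> x Ax; apply: has_derive_within_comp; [exact: Gd|exact: ff'].
Qed.

(** The derivative of 1/f is -f' / f^2, a product of functions of lower order. *)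
Lemma CkV A n f : (forall x, A x -> f x != 0) -> Ck A n f ->
  Ck A n (fun x => (f x)^-1).
Proof.
move=> f0.
have Vd x : A x -> is_derive (f x) 1 (fun y => y^-1) (- (f x) ^- 2 * 1).
  by move=> Ax; apply: is_deriveV; exact: f0.
elim: n => [|n IH] fC.
  split=> //; have [fc _] := fC.
  apply: (@continuous_within_comp A f (fun y => y^-1) (fun y => - y ^- 2 * 1))
    => //.
apply: (@Ck_compS A n f (fun y => y^-1) (fun y => - y ^- 2 * 1)) => //.
rewrite (_ : _ \o _ = fun x => - ((f x)^-1 ^+ 2)); last first.
  by apply/funext => x /=; rewrite mulr1 exprVn.
by apply: CkN; apply: CkX; apply: IH; exact: CkW.
Qed.

End scalar_valued.
End continuously_differentiable.

(** A row vector is the sum of its coordinates times constant vectors. *)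
Lemma Ck_rV (R : realType) (V : normedModType R) (A : set V) n d
    (F : V -> 'rV[R]_d) :
  (forall i, Ck A n (fun x => F x ord0 i)) -> Ck A n F.
Proof.
move=> FC.
rewrite (_ : F = fun x => \sum_(i < d) F x ord0 i *: delta_mx ord0 i).
  by apply: Ck_sum => i; exact: CkZ.
by apply/funext => x; exact: row_sum_delta.
Qed.

(** * Elementary smooth functions on [0, 1) x R^d *)

Section proper_increments.
Context (R : realType).

Lemma increments_proper (V : normedModType R) (A : set V) (v x : V) :
  (forall e : R, 0 < e -> exists h, [/\ h != 0, `|h| < e & A (h *: v + x)]) ->
  ProperFilter (increments A v x).
Proof.
move=> H; apply: Build_ProperFilter_ex => P; rewrite /increments.
case/nbhs_ballP => e /= e0 eP; have [h [h0 he Ah]] := H e e0.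
by exists h; apply: (eP h) => //; rewrite /ball /= sub0r normrN.
Qed.

Lemma increments_setT_proper (V : normedModType R) (v x : V) :
  ProperFilter (increments setT v x).
Proof. by rewrite increments_setT; exact: Proper_dnbhs_numFieldType. Qed.

(** The sign of the increment is that of the time component, so that a point
of the initial slice is moved forward. *)
Lemma time_increment (t tau e : R) : 0 <= t < 1 -> 0 < e ->
  exists h, [/\ h != 0, `|h| < e & 0 <= h * tau + t < 1].
Proof.
move=> /andP[t0 t1] e0; pose k := Num.min e ((1 - t) / (`|tau| + 1)) / 2.
have s0 : 0 < `|tau| + 1 by rewrite ltr_wpDl.
have k0 : 0 < k by rewrite divr_gt0// lt_min e0 divr_gt0// subr_gt0.
have ke : k < e.
  rewrite (@le_lt_trans _ _ (e / 2))// ?ler_pM2r ?invr_gt0 ?ge_min ?lexx//.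
  by rewrite ltr_pdivrMr// mulr_natr mulr2n ltrDl.
have kt : k * `|tau| < 1 - t.
  rewrite (@le_lt_trans _ _ (((1 - t) / (`|tau| + 1) / 2) * `|tau|))//.
    by rewrite ler_wpM2r// ler_pM2r ?invr_gt0// ge_min lexx orbT.
  rewrite [X in X < _](_ : _ = (1 - t) * (`|tau| / (2 * (`|tau| + 1)))); last by field; rewrite gt_eqF.
  rewrite gtr_pMr ?subr_gt0//.
  rewrite ltr_pdivrMr ?mulr_gt0// mul1r; have := normr_ge0 tau; lra.
clearbody k; have [tau0|/ltW tau0] := lerP 0 tau.
  exists k; rewrite gt_eqF// gtr0_norm//; split=> //.
  rewrite ger0_norm// in kt; rewrite addr_ge0 ?mulr_ge0 ?(ltW k0)//=.
  by rewrite -ltrBrDr.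
exists (- k); rewrite oppr_eq0 gt_eqF// normrN gtr0_norm//; split=> //.
rewrite ler0_norm// in kt; rewrite mulNr -mulrN.
rewrite addr_ge0 ?mulr_ge0 ?(ltW k0) ?oppr_ge0//=.
by rewrite -ltrBrDr.
Qed.

Lemma increments_time_proper (v t : R) : 0 <= t < 1 ->
  ProperFilter (increments (`[0, 1[ : set R) v t).
Proof.
move=> t01; apply: increments_proper => e e0.
have [h [h0 he ht]] := time_increment v t01 e0.
by exists h; split=> //=; rewrite in_itv.
Qed.

Lemma increments_time_space_proper d (v z : R * 'rV[R]_d) :
  @time_space R d z -> ProperFilter (increments (@time_space R d) v z).
Proof.
case=> /= t01 _; apply: increments_proper => e e0.
rewrite in_itv/= in t01.
have [h [h0 he ht]] := time_increment v.1 t01 e0.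
by exists h; split=> //; split=> //=; rewrite in_itv.
Qed.

End proper_increments.

Section building_blocks.
Context (R : realType).

Lemma is_derive_exprn n (x : R) :
  is_derive x 1 (fun y => y ^+ n) (n%:R * x ^+ n.-1).
Proof.
have -> : (fun y : R => y ^+ n) = (id : R -> R) ^+ n.
  by elim: n => [|n IH]; apply/funext => y; rewrite ?expr0// !exprS -IH.
have := @is_deriveX R R id n x 1 1 (is_derive_id _ _).
by rewrite /GRing.scale /= mulr1.
Qed.

(** For k = 0 this is the usual smooth function vanishing to infinite order at
0; the powers of x make the family stable under derivation. *)
Definition flat (k : nat) (x : R) : R :=
  if 0 < x then x ^- k * expR (- x^-1) else 0.

Lemma flat_ge0 k x : 0 <= flat k x.
Proof.
rewrite /flat; case: ifPn => // x0.
by rewrite mulr_ge0 ?expR_ge0// invr_ge0 exprn_ge0// ltW.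
Qed.

Lemma flat_gt0 k x : 0 < x -> 0 < flat k x.
Proof. by move=> x0; rewrite /flat x0 mulr_gt0 ?expR_gt0 ?invr_gt0 ?exprn_gt0. Qed.

Lemma flat_eq0 k x : x <= 0 -> flat k x = 0.
Proof. by move=> x0; rewrite /flat ltNge x0. Qed.

Lemma flat0_le1 x : flat 0 x <= 1.
Proof.
rewrite /flat; case: ifPn => // x0.
by rewrite expr0 invr1 mul1r -[leRHS]expR0 ler_expR oppr_le0 invr_ge0 ltW.
Qed.

Lemma flat0_homo x y : x <= y -> flat 0 x <= flat 0 y.
Proof.
move=> xy; have [x0|x0] := leP x 0; first by rewrite flat_eq0// flat_ge0.
have y0 := lt_le_trans x0 xy; rewrite /flat x0 y0 expr0 invr1 !mul1r.
by rewrite ler_expR lerN2 lef_pV2.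
Qed.

(** Obtained from exp (1/x) >= x^-(k+1) / (k+1)!; it makes every flat k vanish
to first order at 0, which is all that differentiability there needs. *)
Lemma flat_le k x : 0 < x -> flat k x <= (k.+1)`!%:R * x.
Proof.
move=> x0; rewrite /flat x0 expRN.
have xi : 0 <= x^-1 by rewrite invr_ge0 ltW.
have := expR_ge1Dxn k xi.
have F : (0 : R) < (k.+1)`!%:R by rewrite ltr0n fact_gt0.
move=> H; rewrite ler_pdivrMr ?expR_gt0//.
have -> : x ^- k = (k.+1)`!%:R * x * (x^-1 ^+ k.+1 / (k.+1)`!%:R).
  rewrite exprS -exprVn; field.
  by rewrite !gt_eqF.
by rewrite ler_wpM2l ?mulr_ge0 ?ltW//; lra.
Qed.

Lemma is_derive_flat k (x : R) :
  is_derive x 1 (flat k) (- k%:R * flat k.+1 x + flat k.+2 x).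
Proof.
have [x0|x0|->] := ltgtP x 0.
- rewrite !flat_eq0 ?ltW// mulr0 addr0.
  apply: (@near_eq_is_derive _ _ _ (cst 0)).
  near=> y; rewrite flat_eq0//.
  by apply/ltW; near: y; exact: lt_nbhsl.
- have xn0 : x != 0 by rewrite gt_eqF.
  have Di : is_derive x 1 (fun y : R => y^-1) (- x ^- 2 *: 1).
    exact: (is_deriveV xn0).
  have De : is_derive x 1 (fun y : R => expR (- y^-1)) (expR (- x^-1) * x ^- 2).
    apply: (@is_derive1_comp _ expR (fun y => - y^-1)).
    by rewrite -[x ^- 2]opprK -[- x ^- 2]mulr1; exact: is_deriveN.
  have Dk : is_derive x 1 (fun y : R => (y ^+ k)^-1)
      (- (x ^+ k) ^- 2 *: (k%:R * x ^+ k.-1)).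
    apply: is_deriveV; first by rewrite expf_neq0.
    exact: is_derive_exprn.
  have Df : is_derive x 1 (fun y : R => (y ^+ k)^-1 * expR (- y^-1))
      (- k%:R * flat k.+1 x + flat k.+2 x).
    apply: is_derive_eq; rewrite /GRing.scale /= /flat x0.
    case: (k) => [|j]; first by rewrite !mulr0n !expr0; field.
    by rewrite !exprS /=; field; rewrite ?xn0 ?expf_neq0.
  apply: near_eq_is_derive Df; near=> y; rewrite /flat ifT//.
  by near: y; exact: lt_nbhsr.
- rewrite !flat_eq0// mulr0 addr0; apply/is_derive_withinT.
  rewrite /has_derive_within increments_setT.
  apply/cvgr0Pnorm_le => e e0; near=> h.
  rewrite /difference_quotient addr0 (@flat_eq0 k 0)// subr0 /GRing.scale /= mulr1.
  have [h0|h0] := leP h 0; first by rewrite flat_eq0// mulr0 normr0 ltW.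
  have -> : h^-1 * flat k h = flat k.+1 h.
    by rewrite /flat h0 exprS invfM mulrA.
  rewrite ger0_norm ?flat_ge0// (le_trans (flat_le _ h0))//.
  rewrite -ler_pdivlMl ?ltr0n ?fact_gt0// -[h]gtr0_norm//.
  by near: h; apply: dnbhs0_le; rewrite mulr_gt0// invr_gt0 ltr0n fact_gt0.
Unshelve. all: by end_near. Qed.

(** The whole family is treated at once, since the derivative of flat k involves
flat k.+1 and flat k.+2. *)
Lemma Ck_flat (V : normedModType R) (A : set V) n (f : V -> R) k :
  Ck A n f -> Ck A n (flat k \o f).
Proof.
elim: n k => [|n IH] k fC.
  split=> //; have [fc _] := fC.
  apply: (@continuous_within_comp _ _ _ _ _
    (fun y => - k%:R * flat k.+1 y + flat k.+2 y)) fc => x _.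
  exact: is_derive_flat.
apply: (@Ck_compS R V A n f (flat k)
   (fun y => - k%:R * flat k.+1 y + flat k.+2 y)) => //.
  by move=> x _; exact: is_derive_flat.
have fC' := CkW fC; apply: CkD; last exact: IH.
by apply: CkM; [exact: Ck_cst|exact: IH].
Qed.

(** The inverse width of the concentrating profile. *)
Definition lam (t : R) : R := (Num.sqrt (1 - t))^-1.

Lemma lam_gt0 t : t < 1 -> 0 < lam t.
Proof. by move=> t1; rewrite /lam invr_gt0 sqrtr_gt0 subr_gt0. Qed.

Lemma lam_ge1 t : 0 <= t < 1 -> 1 <= lam t.
Proof.
move=> /andP[t0 t1]; rewrite /lam invr_ge1 ?unitfE ?gt_eqF ?sqrtr_gt0 ?subr_gt0//.
by rewrite -[leRHS]sqrtr1 ler_wsqrtr; lra.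
Qed.

Lemma is_derive_lam (t : R) : t < 1 -> is_derive t 1 lam (lam t ^+ 3 / 2).
Proof.
move=> t1; have t0 : 0 < 1 - t by rewrite subr_gt0.
have s0 : Num.sqrt (1 - t) != 0 by rewrite gt_eqF// sqrtr_gt0.
have Ds : is_derive t 1 (fun y : R => Num.sqrt (1 - y))
    ((2 * Num.sqrt (1 - t))^-1 * (0 - 1)).
  apply: (@is_derive1_comp _ Num.sqrt (fun y => 1 - y)).
  exact: is_derive1_sqrt.
have := @is_deriveV R (fun y => Num.sqrt (1 - y)) t _ 1 s0 Ds; rewrite -/lam.
rewrite (_ : _ *: _ = lam t ^+ 3 / 2)// /lam /GRing.scale /=.
by field.
Qed.

(** lam' = lam^3 / 2 expresses the derivative by lam itself. *)
Lemma Ck_lam (V : normedModType R) (A : set V) n (f : V -> R) :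
  (forall x, A x -> f x < 1) -> Ck A n f -> Ck A n (lam \o f).
Proof.
move=> f1; elim: n => [|n IH] fC.
  split=> //; have [fc _] := fC.
  apply: (@continuous_within_comp _ _ _ _ _ (fun y => lam y ^+ 3 / 2)) fc.
  by move=> x Ax; apply: is_derive_lam; exact: f1.
apply: (@Ck_compS R V A n f lam (fun y => lam y ^+ 3 / 2)) => //.
  by move=> x Ax; apply: is_derive_lam; exact: f1.
apply: CkM; last exact: Ck_cst.
by apply: (@CkX _ _ _ _ (lam \o f)); apply: IH; exact: CkW.
Qed.

Lemma Ck_coord d n (i : 'I_d) : Ck setT n (fun x : 'rV[R]_d => x ord0 i).
Proof.
apply: Ck_linear; first exact: coord_continuous.
by move=> h y z; rewrite !mxE.
Qed.

Lemma Ck_time d n : Ck (@time_space R d) n fst.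
Proof. by apply: Ck_linear => // x; exact: cvg_fst. Qed.

Lemma Ck_space d n (i : 'I_d) :
  Ck (@time_space R d) n (fun z : R * 'rV[R]_d => z.2 ord0 i).
Proof.
apply: Ck_linear; last by move=> h y z; rewrite !mxE.
move=> x; apply: (@cvg_comp _ _ _ snd (fun v : 'rV[R]_d => v ord0 i)).
  exact: cvg_snd.
exact: coord_continuous.
Qed.

End building_blocks.

(** * Gaussian averages *)

Section gaussian_average.
Context (R : realType).
Let mu := @lebesgue_measure R.
Implicit Types (f g : R -> R).

(** Up to the factor sqrt pi, the expectation of f under the centered normal
law of variance 1/2. *)
Definition gmean f : R := \int[mu]_y (gauss_fun y * f y).

(** The bound 1 + z <= 2 exp (z/2) at z = y^2 leaves a multiple of the standard
normal density. *)
Lemma integrable_gauss_sqr :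
  mu.-integrable setT (fun y => (gauss_fun y * (1 + y ^+ 2))%:E).
Proof.
have p0 : (0 : R) < normal_peak 1 by apply: normal_peak_gt0; exact: oner_neq0.
apply: (@le_integrable _ _ _ mu setT _ _
   (fun y => ((2 / normal_peak 1) * normal_pdf 0 1 y)%:E)) => //.
- apply/measurable_EFinP; apply: measurable_funM => //.
    exact: measurable_gauss_fun.
  by apply: measurable_funD => //; exact: measurable_funX.
- move=> y _; rewrite !abse_EFin lee_fin /normal_pdf (negbTE (oner_neq0 _)).
  have y2 : 0 <= y ^+ 2 by exact: sqr_ge0.
  pose a := expR (- (y ^+ 2 / 2)).
  have a0 : 0 < a by exact: expR_gt0.
  have -> : gauss_fun y = a * a.
    by rewrite /gauss_fun -expRD; congr expR; field.
  have -> : 2 / normal_peak 1 * (normal_peak 1 * normal_fun 0 1 y) = 2 * a.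
    rewrite mulrA divfK ?gt_eqF// /normal_fun subr0 expr1n; congr (_ * expR _).
    by rewrite mulr2n; field.
  rewrite !ger0_norm ?mulr_ge0 ?addr_ge0 ?(ltW a0)//.
  rewrite -mulrA mulrC ler_pM2r// /a expRN ler_pdivrMl ?expR_gt0//.
  by have h := expR_ge1Dx (y ^+ 2 / 2); lra.
- under eq_fun do rewrite EFinM.
  by apply: integrableZl => //; exact: integrable_normal_pdf.
Qed.

(** The weight 1 + y^2 absorbs both powers of y that Taylor expansions in the
dilation factor produce; this one constant then bounds all remainders. *)
Definition gauss_moment : R := gmean (fun y => 1 + y ^+ 2).

Definition subquadratic f := measurable_fun setT f /\
  exists C, forall y, `|f y| <= C * (1 + y ^+ 2).

Lemma integrable_gmean f : subquadratic f ->
  mu.-integrable setT (EFin \o (fun y => gauss_fun y * f y)).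
Proof.
move=> [mf [C fC]]; apply: (@le_integrable _ _ _ mu setT _ _
   (fun y => (C%:E * (gauss_fun y * (1 + y ^+ 2))%:E)%E)) => //.
- apply/measurable_EFinP; apply: measurable_funM => //.
  exact: measurable_gauss_fun.
- move=> y _; rewrite -EFinM !abse_EFin lee_fin /= normrM.
  rewrite (ger0_norm (gauss_fun_ge0 _)) (le_trans _ (ler_norm _))//.
  by rewrite mulrCA ler_wpM2l ?gauss_fun_ge0.
- by apply: integrableZl => //; exact: integrable_gauss_sqr.
Qed.

Lemma subquadraticB f g : subquadratic f -> subquadratic g ->
  subquadratic (fun y => f y - g y).
Proof.
move=> [mf [C fC]] [mg [D gD]]; split; first exact: measurable_funB.
exists (C + D) => y; rewrite (le_trans (ler_normB _ _))// mulrDl.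
exact: lerD.
Qed.

Lemma subquadraticZ c f : subquadratic f -> subquadratic (fun y => c * f y).
Proof.
move=> [mf [C fC]]; split; first exact: measurable_funM.
by exists (`|c| * C) => y; rewrite normrM -mulrA ler_wpM2l.
Qed.

Lemma gmeanB f g : subquadratic f -> subquadratic g ->
  gmean (fun y => f y - g y) = gmean f - gmean g.
Proof.
move=> fq gq; rewrite -RintegralB//; try exact: integrable_gmean.
by apply: eq_Rintegral => y _; rewrite mulrBr.
Qed.

Lemma gmeanZ (c : R) f : subquadratic f -> gmean (fun y => c * f y) = c * gmean f.
Proof.
move=> fq; rewrite -RintegralZl//; last exact: integrable_gmean.
by apply: eq_Rintegral => y _; rewrite mulrCA.
Qed.

Lemma gmean_le f (C : R) : measurable_fun setT f ->
  (forall y, `|f y| <= C * (1 + y ^+ 2)) -> `|gmean f| <= C * gauss_moment.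
Proof.
move=> mf fC; have fq : subquadratic f by split => //; exists C.
have sq : subquadratic (fun y => 1 + y ^+ 2).
  split; first by apply: measurable_funD => //; exact: measurable_funX.
  by exists 1 => y; rewrite mul1r ger0_norm// addr_ge0// sqr_ge0.
rewrite /gauss_moment -gmeanZ// (le_trans (le_normr_Rintegral _ _))//.
  exact: integrable_gmean.
apply: le_Rintegral => //.
- rewrite (_ : _ \o _ = abse \o (EFin \o (fun y => gauss_fun y * f y))).
    by apply: integrable_abse => //; exact: integrable_gmean.
  by apply/funext => y.
- by apply: integrable_gmean; exact: subquadraticZ.
- move=> y _; rewrite normrM (ger0_norm (gauss_fun_ge0 _)).
  by rewrite ler_wpM2l ?gauss_fun_ge0.
Qed.

End gaussian_average.

(** * Gaussian averages of dilated test functions *)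

Section test_functions.
Context (R : realType).
Implicit Types (phi : nat -> R -> R).

(** A smooth compactly supported function of one variable, given together with
all its derivatives. *)
Record test_function phi : Prop := TestFunction {
  test_derive : forall k (x : R), is_derive x 1 (phi k) (phi k.+1 x);
  test_support : exists L, forall k x, L < `|x| -> phi k x = 0;
  test_bound : forall k, exists M, forall x, `|phi k x| <= M }.

Lemma is_derive_continuous (f : R -> R) (x df : R) :
  is_derive x 1 f df -> f @ x --> f x.
Proof. by case=> /derivable1_diffP/differentiable_continuous. Qed.

Lemma mean_value (f f' : R -> R) : (forall x : R, is_derive x 1 f (f' x)) ->
  forall a b, exists2 c, `|c - a| <= `|b - a| & f b - f a = f' c * (b - a).
Proof.
move=> fd a b.
have fc A : {within A, continuous f}.
  by apply: continuous_subspaceT => x; exact: is_derive_continuous (fd x).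
have [ab|ba|<-] := ltgtP a b.
- have [c /[!in_itv]/= /andP[ac cb] fE] := MVT ab (fun x _ => fd x) (fc _).
  by exists c => //; rewrite !gtr0_norm ?subr_gt0// lerD2r ltW.
- have [c /[!in_itv]/= /andP[bc ca] fE] := MVT ba (fun x _ => fd x) (fc _).
  exists c; first by rewrite !ltr0_norm ?subr_lt0// lerN2 lerD2r ltW.
  by rewrite -opprB fE -mulrN opprB.
- by exists a => //; rewrite !subrr mulr0.
Qed.

Lemma derive_lipschitz (f f' : R -> R) M : (forall x : R, is_derive x 1 f (f' x)) ->
  (forall x, `|f' x| <= M) -> forall a b, `|f b - f a| <= M * `|b - a|.
Proof.
move=> fd fM a b; have [c _ ->] := mean_value fd a b.
by rewrite normrM ler_wpM2r.
Qed.

(** Two uses of the mean value theorem; the constant is not sharp. *)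
Lemma derive_taylor (f f' f'' : R -> R) M :
  (forall x : R, is_derive x 1 f (f' x)) -> (forall x : R, is_derive x 1 f' (f'' x)) ->
  (forall x, `|f'' x| <= M) ->
  forall a e, `|f (a + e) - f a - e * f' a| <= M * e ^+ 2.
Proof.
move=> fd f'd fM a e; have [c + ->] := mean_value fd a (a + e).
rewrite [a + e]addrC addrK mulrC -mulrBr normrM => ca.
rewrite -[e ^+ 2]real_normK ?num_real// expr2 [leLHS]mulrC [leRHS]mulrA ler_wpM2r//.
apply: le_trans (derive_lipschitz f'd fM a c) _; rewrite ler_wpM2l//.
exact: le_trans (fM 0).
Qed.

Context phi (phi_test : test_function phi).

Lemma test_measurable k : measurable_fun setT (phi k).
Proof.
apply: continuous_measurable_fun => x.
exact: is_derive_continuous (test_derive phi_test k x).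
Qed.

Lemma test_measurable_affine k (x s : R) :
  measurable_fun setT (fun y => phi k (x + s * y)).
Proof.
apply: measurableT_comp; first exact: test_measurable.
by apply: measurable_funD => //; exact: measurable_funM.
Qed.

Lemma le_norm_weight (y : R) : `|y| <= 1 + y ^+ 2.
Proof.
rewrite -[y ^+ 2]real_normK ?num_real//; have := normr_ge0 y; nra.
Qed.

Lemma test_subquadratic k (x s : R) :
  subquadratic (fun y => phi k (x + s * y)).
Proof.
split; first exact: test_measurable_affine.
have [M phiM] := test_bound phi_test k; exists M => y.
have M0 : 0 <= M by exact: le_trans (phiM 0).
by rewrite (le_trans (phiM _))// ler_peMr// lerDl sqr_ge0.
Qed.

Lemma test_subquadraticM k (x s : R) :
  subquadratic (fun y => y * phi k (x + s * y)).
Proof.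
split; first by apply: measurable_funM => //; exact: test_measurable_affine.
have [M phiM] := test_bound phi_test k; exists M => y.
by rewrite normrM mulrC ler_pM//; exact: le_norm_weight.
Qed.

(** At s = 2 sqrt t this is the heat evolution at time t. In the variable s it is
differentiable everywhere, including s = 0. *)
Definition dilate_mean k (s x : R) : R := gmean (fun y => phi k (x + s * y)).

Lemma dilate_mean_lipschitz k : exists C, forall s x s' x',
  `|dilate_mean k s' x' - dilate_mean k s x| <= C * (`|x' - x| + `|s' - s|).
Proof.
have [M phiM] := test_bound phi_test k.+1.
have M0 : 0 <= M by exact: le_trans (phiM 0).
exists (M * gauss_moment R) => s x s' x'.
rewrite /dilate_mean -gmeanB; [|exact: test_subquadratic..].
rewrite mulrAC; apply: gmean_le.
  by apply: measurable_funB; exact: test_measurable_affine.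
move=> y; apply: le_trans (derive_lipschitz (test_derive phi_test k) phiM _ _) _.
rewrite -mulrA ler_wpM2l//.
rewrite [X in `|X|](_ : _ = (x' - x) + (s' - s) * y); last by ring.
rewrite (le_trans (ler_normD _ _))// [leRHS]mulrDl lerD//.
  by rewrite ler_peMr// lerDl sqr_ge0.
by rewrite normrM ler_wpM2l// le_norm_weight.
Qed.

(** The error term is quadratic uniformly in s and x. This uniformity is what
allows space and time increments to be taken simultaneously later. *)
Lemma dilate_mean_space k : exists C, forall s x e,
  `|dilate_mean k s (x + e) - dilate_mean k s x - e * dilate_mean k.+1 s x|
    <= C * e ^+ 2.
Proof.
have [M phiM] := test_bound phi_test k.+2.
have M0 : 0 <= M by exact: le_trans (phiM 0).
exists (M * gauss_moment R) => s x e; rewrite /dilate_mean.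
rewrite -gmeanB; [|exact: test_subquadratic..].
rewrite -gmeanZ; last exact: test_subquadratic.
rewrite -gmeanB; last 2 first.
- by apply: subquadraticB; exact: test_subquadratic.
- by apply: subquadraticZ; exact: test_subquadratic.
rewrite mulrAC; apply: gmean_le.
  apply: measurable_funB; last first.
    by apply: measurable_funM => //; exact: test_measurable_affine.
  by apply: measurable_funB; exact: test_measurable_affine.
move=> y; rewrite [x + e + _]addrAC.
apply: le_trans (derive_taylor (test_derive phi_test k)
  (test_derive phi_test k.+1) phiM _ _) _.
by rewrite ler_peMr ?lerDl ?sqr_ge0// mulr_ge0 ?sqr_ge0.
Qed.

Lemma dilate_mean_dilation k : exists C, forall s x e,
  `|dilate_mean k (s + e) x - dilate_mean k s x -
    e * gmean (fun y => y * phi k.+1 (x + s * y))| <= C * e ^+ 2.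
Proof.
have [M phiM] := test_bound phi_test k.+2.
have M0 : 0 <= M by exact: le_trans (phiM 0).
exists (M * gauss_moment R) => s x e; rewrite /dilate_mean.
rewrite -gmeanB; [|exact: test_subquadratic..].
rewrite -gmeanZ; last exact: test_subquadraticM.
rewrite -gmeanB; last 2 first.
- by apply: subquadraticB; exact: test_subquadratic.
- by apply: subquadraticZ; exact: test_subquadraticM.
rewrite mulrAC; apply: gmean_le.
  apply: measurable_funB; last first.
    apply: measurable_funM => //; apply: measurable_funM => //.
    exact: test_measurable_affine.
  by apply: measurable_funB; exact: test_measurable_affine.
move=> y; rewrite [(s + e) * y]mulrDl addrA [e * (y * _)]mulrA.
apply: le_trans (derive_taylor (test_derive phi_test k)
  (test_derive phi_test k.+1) phiM _ _) _.
rewrite -mulrA ler_wpM2l// exprMn ler_wpM2l ?sqr_ge0//.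
by rewrite lerDr.
Qed.

End test_functions.

(** * The heat evolution of a test function *)

Section heat_evolution.
Context (R : realType) (phi : nat -> R -> R) (phi_test : test_function phi).
Let mu := @lebesgue_measure R.

Lemma is_derive_gauss_fun (y : R) :
  is_derive y 1 gauss_fun (- 2 * y * gauss_fun y).
Proof.
have D2 : is_derive y 1 (fun y : R => - y ^+ 2) (- (2%:R * y ^+ 1)).
  exact: (is_deriveN (is_derive_exprn 2 y)).
have := @is_derive1_comp R expR (fun y => - y ^+ 2) y _ _ (is_derive_expR _) D2.
by move=> /is_derive_eq; apply; rewrite /gauss_fun expr1; ring.
Qed.

(** Gaussian integration by parts: the derivative of the compactly supported
function gauss_fun y * phi k (x + s * y) has integral zero. *)
Lemma gauss_by_parts k (s x : R) : 0 < s ->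
  gmean (fun y => y * phi k (x + s * y)) = s / 2 * dilate_mean phi k.+1 s x.
Proof.
move=> s0; have [L phiL] := test_support phi_test.
(* When |y| >= Y, the point x + s y lies outside the support of phi. *)
pose Y := (`|L| + `|x|) / s + 1.
have Y0 : 0 < Y by rewrite ltr_wpDl// divr_ge0 ?addr_ge0// ltW.
have phi0 j y : Y <= `|y| -> phi j (x + s * y) = 0.
  move=> Yy; apply: phiL; have sY : `|L| + `|x| < s * `|y|.
    by rewrite -ltr_pdivrMl// mulrC (lt_le_trans _ Yy)// ltrDl.
  have := lerB_normD (s * y) x; rewrite [s * y + x]addrC normrM (gtr0_norm s0) => h.
  by have := ler_norm L; lra.
pose F y := gauss_fun y * phi k (x + s * y).
pose F' y := s * (gauss_fun y * phi k.+1 (x + s * y)) -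
   2 * (gauss_fun y * (y * phi k (x + s * y))).
have Daff (y : R) : is_derive y 1 (fun y => x + s * y) s.
  rewrite -[X in is_derive _ _ _ X]add0r -[s in 0 + s]mulr1.
  apply: is_deriveD.
have Dphi j (y : R) : is_derive y 1 (fun y => phi j (x + s * y))
    (phi j.+1 (x + s * y) * s).
  apply: (@is_derive1_comp R (phi j) (fun y => x + s * y)).
  exact: test_derive.
have DF (y : R) : is_derive y 1 F (F' y).
  have := @is_deriveM R R gauss_fun (fun y => phi k (x + s * y)) y 1 _ _
    (is_derive_gauss_fun y) (Dphi k y).
  move=> /is_derive_eq; apply; rewrite /F' /GRing.scale /=; ring.
have phic j : continuous (fun y => phi j (x + s * y)).
  by move=> y; exact: is_derive_continuous (Dphi j y).
have F'c : continuous F'.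
  move=> y; apply: cvgB; apply: cvgM; try exact: cvg_cst.
    by apply: cvgM; [exact: continuous_gauss_fun|exact: phic].
  apply: cvgM; first exact: continuous_gauss_fun.
  by apply: cvgM; [exact: cvg_id|exact: phic].
have F'0 : \int[mu]_y F' y = 0.
  transitivity (\int[mu]_(y in `[- Y, Y]) F' y).
    rewrite [RHS]Rintegral_mkcond; apply: eq_Rintegral => y _.
    rewrite patchE; case: ifPn => //; rewrite notin_setE/= in_itv/= => /negP.
    rewrite -ler_norml -ltNge => /ltW Yy.
    by rewrite /F' !phi0// !mulr0 subrr.
  rewrite /Rintegral (@continuous_FTC2 _ F' F).
  - by rewrite /F !phi0 ?normrN ?(gtr0_norm Y0)// !mulr0 subee.
  - by rewrite gtrN.
  - exact: continuous_subspaceT.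
  - split.
    + by move=> y _; have [] := DF y.
    + apply: cvg_at_right_filter; exact: is_derive_continuous (DF _).
    + apply: cvg_at_left_filter; exact: is_derive_continuous (DF _).
  - by move=> y _; rewrite derive1E; have [_ ->] := DF y.
move: F'0; rewrite /F' RintegralB//; last 2 first.
- under [X in _.-integrable _ (_ \o X)]eq_fun do rewrite mulrCA.
  apply: integrable_gmean; apply: subquadraticZ; exact: test_subquadratic.
- under [X in _.-integrable _ (_ \o X)]eq_fun do rewrite mulrCA.
  apply: integrable_gmean; apply: subquadraticZ; exact: test_subquadraticM.
rewrite !RintegralZl//; last 2 first.
- apply: integrable_gmean; exact: test_subquadraticM.
- apply: integrable_gmean; exact: test_subquadratic.
by rewrite /dilate_mean /gmean -/mu; lra.
Qed.

Lemma quadratic_is_derive (f : R -> R) (x l C : R) :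
  (forall e, `|f (x + e) - f x - e * l| <= C * e ^+ 2) -> is_derive x 1 f l.
Proof.
move=> fC; apply/is_derive_withinT; rewrite /has_derive_within increments_setT.
have C0 : 0 <= C by have := fC 1; rewrite expr1n mulr1; exact: le_trans.
apply/cvgrPdist_le => e e0; near=> h.
have h0 : h != 0 by near: h; exact: nbhs_dnbhs_neq.
rewrite /difference_quotient /GRing.scale /= mulr1 [h + x]addrC distrC.
rewrite (_ : _ - l = h^-1 * (f (x + h) - f x - h * l)); last by field.
rewrite normrM normfV ler_pdivrMl ?normr_gt0//.
rewrite (le_trans (fC h))// -[h ^+ 2]real_normK ?num_real// expr2 mulrCA.
rewrite ler_wpM2l// (@le_trans _ _ ((C + 1) * `|h|))//.
  by rewrite ler_wpM2r// lerDl.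
rewrite -ler_pdivlMl ?ltr_wpDl//.
by near: h; apply: dnbhs0_le; rewrite mulr_gt0// invr_gt0 ltr_wpDl.
Unshelve. all: by end_near. Qed.

(** Up to the factor sqrt pi, the solution of the heat equation with initial
datum phi k. *)
Definition heat k (t x : R) : R := dilate_mean phi k (2 * Num.sqrt t) x.

Lemma is_derive_heat_space k (t x : R) :
  is_derive x 1 (heat k t) (heat k.+1 t x).
Proof.
have [C HC] := dilate_mean_space phi_test k.
by apply: (@quadratic_is_derive _ _ _ C) => e; exact: HC.
Qed.

(** The derivative in the dilation factor s is s/2 times the mean of the second
derivative by Gaussian integration by parts, and the factor s cancels against
the derivative 2/s of s = 2 sqrt t. *)
Lemma is_derive_heat_time k (t x : R) : 0 < t ->
  is_derive t 1 (heat k ^~ x) (heat k.+2 t x).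
Proof.
move=> t0; have s0 : 0 < 2 * Num.sqrt t by rewrite mulr_gt0// sqrtr_gt0.
have [C HC] := dilate_mean_dilation phi_test k.
have Ds : is_derive (2 * Num.sqrt t) 1 (dilate_mean phi k ^~ x)
    (gmean (fun y => y * phi k.+1 (x + 2 * Num.sqrt t * y))).
  by apply: (@quadratic_is_derive _ _ _ C) => e; exact: HC.
have Dt : is_derive t 1 (fun t => 2 * Num.sqrt t) (2 * (2 * Num.sqrt t)^-1).
  by apply: is_deriveZ; exact: is_derive1_sqrt.
have := @is_derive1_comp R (dilate_mean phi k ^~ x) _ t _ _ Ds Dt.
move=> /is_derive_eq; apply; rewrite gauss_by_parts// /heat.
have r0 : Num.sqrt t != 0 by rewrite gt_eqF// sqrtr_gt0.
by field.
Qed.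

(** Continuity at t = 0, where sqrt is not differentiable, still follows from
the Lipschitz bound in the dilation factor. *)
Lemma continuous_heat_time k (x : R) : continuous (heat k ^~ x).
Proof.
move=> t; have [C HC] := dilate_mean_lipschitz phi_test k.
have C0 : 0 <= C.
  by have := HC 0 0 0 1; rewrite !subr0 normr1 normr0 addr0 mulr1; exact: le_trans.
have sc : C * `|2 * Num.sqrt u - 2 * Num.sqrt t| @[u --> t] --> 0.
  rewrite -[X in _ --> X](mulr0 C); apply: cvgM; first exact: cvg_cst.
  rewrite [X in _ --> X](_ : 0 = `|(2 * Num.sqrt t) - (2 * Num.sqrt t)|); last by rewrite subrr normr0.
  apply: (@cvg_norm _ R); apply: cvgB; last exact: cvg_cst.
  by apply: cvgM; [exact: cvg_cst|exact: sqrt_continuous].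
apply/cvgrPdist_le => e e0; near=> u; rewrite distrC.
apply: (@le_trans _ _ (C * `|2 * Num.sqrt u - 2 * Num.sqrt t|)).
  by have := HC (2 * Num.sqrt t) x (2 * Num.sqrt u) x; rewrite subrr normr0 add0r.
apply: (le_trans (ler_norm _)); near: u.
by move/cvgr0Pnorm_le : sc; apply.
Unshelve. all: by end_near. Qed.

Lemma ler_dist_sqrt (s t : R) : 0 <= s -> 0 <= t ->
  `|Num.sqrt s - Num.sqrt t| <= Num.sqrt `|s - t|.
Proof.
wlog st : s t / t <= s.
  move=> H s0 t0; have [|/ltW] := leP t s => st; first exact: H.
  by rewrite distrC [`|s - t|]distrC; exact: H.
move=> s0 t0; rewrite !ger0_norm ?subr_ge0 ?ler_wsqrtr//.
have a0 := sqrtr_ge0 t; have b0 := sqrtr_ge0 (s - t); have c0 := sqrtr_ge0 s.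
rewrite lerBlDr -ler_sqr ?nnegrE ?addr_ge0// sqrrD !sqr_sqrtr ?subr_ge0//.
by have := mulr_ge0 b0 a0; lra.
Qed.

Lemma heat_modulus k : exists2 C, 0 <= C & forall t x t' x',
  0 <= t -> 0 <= t' ->
  `|heat k t' x' - heat k t x| <= C * (`|x' - x| + 2 * Num.sqrt `|t' - t|).
Proof.
have [C HC] := dilate_mean_lipschitz phi_test k.
have C0 : 0 <= C.
  by have := HC 0 0 0 1; rewrite !subr0 normr1 normr0 addr0 mulr1; exact: le_trans.
exists C => // t x t' x' t0 t'0; apply: (le_trans (HC _ _ _ _)).
rewrite ler_wpM2l// lerD2l -mulrBr normrM ger0_norm// ler_wpM2l//.
exact: ler_dist_sqrt.
Qed.

(** The heat equation holds for t > 0 only, but the mean value theorem requires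
derivatives in the interior alone; it thus carries the estimate up to t = 0. *)
Lemma heat_mean_value k (t t' x : R) : 0 <= t -> 0 <= t' ->
  exists c, [/\ 0 <= c, `|c - t| <= `|t' - t| &
    heat k t' x - heat k t x = heat k.+2 c x * (t' - t)].
Proof.
move=> t0 t'0.
have hc A : {within A, continuous (heat k ^~ x)}.
  by apply: continuous_subspaceT; exact: continuous_heat_time.
have hd (a b : R) : 0 <= a -> forall s : R, s \in `]a, b[ ->
    is_derive s 1 (heat k ^~ x) (heat k.+2 s x).
  move=> a0 s; rewrite in_itv/= => /andP[sa _].
  by apply: is_derive_heat_time; exact: le_lt_trans sa.
have [ab|ba|<-] := ltgtP t t'.
- have [c /[!in_itv]/= /andP[ac cb] fE] := MVT ab (hd _ _ t0) (hc _).
  exists c; split=> //; first by rewrite (le_trans t0)// ltW.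
  by rewrite !gtr0_norm ?subr_gt0// lerD2r ltW.
- have [c /[!in_itv]/= /andP[bc ca] fE] := MVT ba (hd _ _ t'0) (hc _).
  exists c; split; first by rewrite (le_trans t'0)// ltW.
    by rewrite !ltr0_norm ?subr_lt0// lerN2 lerD2r ltW.
  by rewrite -opprB fE -mulrN opprB.
- by exists t; rewrite !subrr mulr0.
Qed.

(** First order expansion in time and space, valid up to the boundary t = 0: the
derivatives of heat k are again of the form heat j. *)
Lemma heat_taylor k : exists2 C, 0 <= C & forall t x t' x',
  0 <= t -> 0 <= t' ->
  `|heat k t' x' - heat k t x -
    ((t' - t) * heat k.+2 t x + (x' - x) * heat k.+1 t x)| <=
  C * (`|t' - t| * (`|x' - x| + 2 * Num.sqrt `|t' - t|) + (x' - x) ^+ 2).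
Proof.
have [C C0 HC] := heat_modulus k.+2; have [D HD] := dilate_mean_space phi_test k.
have D0 : 0 <= D by have := HD 0 0 1; rewrite expr1n mulr1; exact: le_trans.
exists (C + D); first exact: addr_ge0.
move=> t x t' x' t0 t'0.
have [c [c0 ct hE]] := heat_mean_value k x' t0 t'0.
rewrite (_ : _ - _ = (t' - t) * (heat k.+2 c x' - heat k.+2 t x) +
   (heat k t x' - heat k t x - (x' - x) * heat k.+1 t x)); last first.
  by rewrite mulrBr [_ * heat k.+2 c x']mulrC -hE; ring.
apply: (le_trans (ler_normD _ _)).
set a := `|t' - t| * _; set e := (x' - x) ^+ 2.
have a0 : 0 <= a.
  by rewrite mulr_ge0// addr_ge0// mulr_ge0// sqrtr_ge0.
have e0 : 0 <= e by exact: sqr_ge0.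
apply: (@le_trans _ _ (C * a + D * e)); last first.
  rewrite mulrDr !mulrDl lerD// ?lerDl ?lerDr mulr_ge0//.
apply: lerD.
  rewrite normrM /a mulrCA ler_wpM2l//; apply: (le_trans (HC _ _ _ _ t0 c0)).
  by rewrite ler_wpM2l// lerD2l ler_wpM2l// ler_wsqrtr.
by have := HD (2 * Num.sqrt t) x (x' - x); rewrite addrCA subrr addr0.
Qed.

Lemma has_derive_within_heat d k (i : 'I_d) (v z : R * 'rV[R]_d) :
  @time_space R d z ->
  has_derive_within (@time_space R d) (fun z => heat k z.1 (z.2 ord0 i)) v z
    (v.1 * heat k.+2 z.1 (z.2 ord0 i) + v.2 ord0 i * heat k.+1 z.1 (z.2 ord0 i)).
Proof.
move=> -[/= /[!in_itv]/= /andP[z0 _] _]; have [C C0 HC] := heat_taylor k.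
pose B h := C * (`|v.1| * (`|h * v.2 ord0 i| + 2 * Num.sqrt `|h * v.1|) +
  `|h| * v.2 ord0 i ^+ 2).
have Bc : B h @[h --> increments (@time_space R d) v z] --> 0.
  have hc (w : R) : `|h * w| @[h --> 0] --> (0 : R).
    rewrite [X in _ --> X](_ : 0 = `|0 * w|); last by rewrite mul0r normr0.
    apply: (@cvg_norm _ R).
    by apply: cvgM; [exact: cvg_id|exact: cvg_cst].
  rewrite [X in _ --> X](_ : 0 =
      C * (`|v.1| * (0 + 2 * 0) + 0 * v.2 ord0 i ^+ 2)); last first.
    by rewrite mulr0 mul0r !addr0 !mulr0.
  apply: cvg_within_filter; apply: cvg_within_filter.
  apply: cvgM; first exact: cvg_cst.
  apply: cvgD; last first.
    apply: cvgM; last exact: cvg_cst.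
    by rewrite -[X in _ --> X](@normr0 _ R); apply: (@cvg_norm _ R); exact: cvg_id.
  apply: cvgM; first exact: cvg_cst.
  apply: cvgD; first exact: hc.
  apply: cvgM; first exact: cvg_cst.
  rewrite -[X in _ --> X]sqrtr0.
  by apply: (cvg_comp _ _ (hc v.1)); exact: sqrt_continuous.
apply/cvgrPdist_le => e e0; near=> h.
have h0 : h != 0 by near: h; exact: increments_neq0.
have : time_space (h *: v + z) by near: h; exact: increments_in.
case=> /= /[!in_itv]/= /andP[hz0 _] _.
apply: (@le_trans _ _ (B h)); last first.
  rewrite (le_trans (ler_norm _))//; near: h.
  by move/cvgr0Pnorm_le : Bc; apply.
rewrite distrC /difference_quotient /GRing.scale /= !mxE.
set t' := h * v.1 + z.1; set x' := h * v.2 ord0 i + z.2 ord0 i.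
have tE : t' - z.1 = h * v.1 by rewrite addrK.
have xE : x' - z.2 ord0 i = h * v.2 ord0 i by rewrite addrK.
have := HC z.1 (z.2 ord0 i) t' x' z0 hz0; rewrite tE xE => {}HC.
set l := v.1 * _ + _; rewrite (_ : _ - l =
  h^-1 * (heat k t' x' - heat k z.1 (z.2 ord0 i) - (h * v.1 * heat k.+2 z.1 (z.2 ord0 i) +
  h * v.2 ord0 i * heat k.+1 z.1 (z.2 ord0 i)))); last by rewrite /l; field.
rewrite normrM normfV ler_pdivrMl ?normr_gt0// (le_trans HC)// /B.
rewrite mulrCA ler_wpM2l// [leRHS]mulrDr exprMn lerD//.
  by rewrite mulrA -normrM.
by rewrite -[h ^+ 2]real_normK ?num_real// -mulrA.
Unshelve. all: by end_near. Qed.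

Lemma Ck_heat d n k (i : 'I_d) :
  Ck (@time_space R d) n (fun z => heat k z.1 (z.2 ord0 i)).
Proof.
have hc j : {within @time_space R d, continuous
    (fun z : R * 'rV[R]_d => heat j z.1 (z.2 ord0 i))}.
  apply/subspace_continuousP => z [/= /[!in_itv]/= /andP[z0 _] _].
  have [C C0 HC] := heat_modulus j.
  pose B (y : R * 'rV[R]_d) : R :=
    C * (`|y.2 ord0 i - z.2 ord0 i| + 2 * Num.sqrt `|y.1 - z.1|).
  have Bc : B y @[y --> within (@time_space R d) (nbhs z)] --> 0.
    rewrite [X in _ --> X](_ : 0 = C * (0 + 2 * 0)); last first.
      by rewrite mulr0 addr0 mulr0.
    apply: cvg_within_filter.
    apply: cvgM; first exact: cvg_cst.
    apply: cvgD.
      rewrite [X in _ --> X](_ : 0 = `|(z.2 ord0 i) - (z.2 ord0 i)|); last by rewrite subrr normr0.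
    apply: (@cvg_norm _ R).
      apply: cvgB; last exact: cvg_cst.
      apply: (@cvg_comp _ _ _ snd (fun v : 'rV[R]_d => v ord0 i)).
        exact: cvg_snd.
      exact: coord_continuous.
    apply: cvgM; first exact: cvg_cst.
    rewrite -[X in _ --> X]sqrtr0.
    have tc : `|y.1 - z.1| @[y --> nbhs z] --> (0 : R).
      rewrite [X in _ --> X](_ : 0 = `|z.1 - z.1|); last by rewrite subrr normr0.
    apply: (@cvg_norm _ R).
      by apply: cvgB; [exact: cvg_fst|exact: cvg_cst].
    by apply: (cvg_comp _ _ tc); exact: sqrt_continuous.
  apply/cvgrPdist_le => e e0; near=> y.
  have : time_space y by near: y; rewrite near_withinE; exact: nearW.
  case=> /= /[!in_itv]/= /andP[y0 _] _.
  rewrite /from_subspace distrC; apply: (@le_trans _ _ (B y)); first exact: HC.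
  rewrite (le_trans (ler_norm _))//; near: y.
  by move/cvgr0Pnorm_le : Bc; apply.
elim: n k => [|n IH] k; split=> //.
move=> v; exists (fun z : R * 'rV[R]_d => v.1 * heat k.+2 z.1 (z.2 ord0 i) +
  v.2 ord0 i * heat k.+1 z.1 (z.2 ord0 i)).
  by apply: CkD; apply: CkM; try exact: IH; exact: Ck_cst.
by move=> z; exact: has_derive_within_heat.
Unshelve. all: by end_near. Qed.

End heat_evolution.

(** * Bump functions, profiles and the background solution *)

Section smooth_test_functions.
Context (R : realType).

Definition derivatives (f : R -> R) (k : nat) : R -> R :=
  iter_derive_within setT f (nseq k 1).

Lemma is_derive_derivatives f : smooth_on setT f -> forall k (x : R),
  is_derive x 1 (derivatives f k) (derivatives f k.+1 x).
Proof.
move=> fs k x; apply/is_derive_withinT.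
by have [_ /(_ x 1 I)] := fs (nseq k 1).
Qed.

(** Derivatives of all orders vanish where f does, and a continuous function
vanishing outside a segment is bounded. *)
Lemma smooth_test_function f L : (forall n, Ck setT n f) ->
  (forall x, L < `|x| -> f x = 0) -> test_function (derivatives f).
Proof.
move=> fC fL.
have fs : smooth_on setT f.
  by apply: Ck_smooth_on fC => v x _; exact: increments_setT_proper.
have fD := is_derive_derivatives fs.
have f0 k x : L < `|x| -> derivatives f k x = 0.
  elim: k x => [//|k IH] x Lx.
  have [_ <-] := fD k x; rewrite -(derive_cst (0 : R) x 1).
  apply: near_eq_derive; near=> y; apply: IH; near: y.
  have /cvgr_gt : `|y| @[y --> x] --> `|x| by exact: norm_continuous.
  by apply.
split=> // [|k]; first by exists L.
pose a := `|L| + 1.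
have a0 : 0 < a by rewrite ltr_wpDl.
have [||c _ Hc] := @EVT_max R (fun x => `|derivatives f k x|) (- a) a.
- by lra.
- apply: continuous_subspaceT => x.
  have fx := is_derive_continuous (fD k x).
  by apply: (cvg_comp _ _ fx); exact: norm_continuous.
- exists `|derivatives f k c| => x; have [xa|ax] := lerP `|x| a.
    by apply: Hc; rewrite in_itv/= -ler_norml.
  rewrite f0 ?normr0// (le_lt_trans (ler_norm _))//.
  by rewrite (lt_trans _ ax)// /a ltrDl.
Unshelve. all: by end_near. Qed.

Lemma Ck_test phi (V : normedModType R) (A : set V) n k (f : V -> R) :
  test_function phi -> Ck A n f -> Ck A n (phi k \o f).
Proof.
move=> [phiD _ _]; elim: n k => [|n IH] k fC.
  split=> //; have [fc _] := fC.
  by apply: (@continuous_within_comp _ _ _ _ _ (phi k.+1)) fc => x _.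
by apply: (@Ck_compS R V A n f (phi k) (phi k.+1)) => //; exact/IH/CkW.
Qed.

Definition hat (r x : R) : R := flat 0 (r - x ^+ 2).

Lemma hat_ge0 r x : 0 <= hat r x. Proof. exact: flat_ge0. Qed.

Lemma hat_le1 r x : hat r x <= 1. Proof. exact: flat0_le1. Qed.

(** When r >= 1 the support of hat r, which is [- sqrt r, sqrt r], is contained
in [- r, r]. *)
Lemma hat_eq0 r x : 0 <= r -> r < `|x| -> r ^+ 2 >= r -> hat r x = 0.
Proof.
move=> r0 rx rr; rewrite /hat flat_eq0// subr_le0 (le_trans rr)//.
by rewrite -[x ^+ 2]real_normK ?num_real// ler_sqr ?nnegrE// ltW.
Qed.

Lemma Ck_hat (V : normedModType R) (A : set V) n r (f : V -> R) :
  Ck A n f -> Ck A n (hat r \o f).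
Proof.
move=> fC; apply: (@Ck_flat R V A n (fun x => r - f x ^+ 2)).
by apply: CkB; [exact: Ck_cst|exact: CkX].
Qed.

Lemma Ck_id A n : Ck A n (id : R -> R).
Proof. by apply: Ck_linear => // x; exact: cvg_id. Qed.

Lemma hat_test r : 0 <= r -> r ^+ 2 >= r -> test_function (derivatives (hat r)).
Proof.
move=> r0 rr; apply: (@smooth_test_function _ r).
  by move=> n; apply: Ck_hat; exact: Ck_id.
by move=> x rx; exact: hat_eq0.
Qed.

(** The concentrating profile is a power of a bump function, so that its
derivative is controlled by a power of the profile arbitrarily close to 1. *)
Definition profile m (x : R) : R := hat 1 x ^+ m.

Lemma profile_test m : (0 < m)%N -> test_function (derivatives (profile m)).
Proof.
move=> m0; apply: (@smooth_test_function _ 1).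
  by move=> n; apply: CkX; apply: Ck_hat; exact: Ck_id.
by move=> x x1; rewrite /profile hat_eq0 ?expr1n// expr0n gtn_eqF.
Qed.

Lemma profile_eq0 m k (x : R) : (0 < m)%N -> 1 < `|x| ->
  derivatives (profile m) k x = 0.
Proof.
move=> m0 x1; elim: k x x1 => [|k IH] x x1.
  by rewrite /derivatives /= /profile hat_eq0 ?expr1n// expr0n gtn_eqF.
have [D _ _] := profile_test m0.
have [_ <-] := D k x; rewrite -(derive_cst (0 : R) x 1).
apply: near_eq_derive; near=> y; apply: IH; near: y.
have /cvgr_gt : `|y| @[y --> x] --> `|x| by exact: norm_continuous.
by apply.
Unshelve. all: by end_near. Qed.

Lemma profile_ge0 m x : 0 <= profile m x.
Proof. by rewrite exprn_ge0// hat_ge0. Qed.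

(** The derivative of a power (hat 1)^(m+1) still contains the factor
(hat 1)^m. *)
Lemma profile_derivative_bound m : exists2 C, 0 <= C & forall x,
  `|derivatives (profile m.+1) 1 x| <= C * hat 1 x ^+ m.
Proof.
have bt : test_function (derivatives (hat 1)) by apply: hat_test; rewrite ?expr1n.
have [C HC] := test_bound bt 1.
have C0 : 0 <= C by exact: le_trans (HC 0).
exists (m.+1%:R * C) => [|x]; first by rewrite mulr_ge0.
have Dp : is_derive x 1 (profile m.+1)
    (m.+1%:R * hat 1 x ^+ m * derivatives (hat 1) 1 x).
  apply: (@is_derive1_comp R (fun y => y ^+ m.+1) (hat 1)).
    exact: (is_derive_exprn m.+1 (hat 1 x)).
  exact: (test_derive bt 0 x).
have [_ <-] := test_derive (profile_test (ltn0Sn m)) 0 x.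
have -> : 'D_1 (derivatives (profile m.+1) 0) x =
  m.+1%:R * hat 1 x ^+ m * derivatives (hat 1) 1 x by have [_ <-] := Dp.
rewrite !normrM normr_nat (ger0_norm (exprn_ge0 m (hat_ge0 1 x))).
by rewrite -!mulrA ler_wpM2l// mulrC ler_wpM2r// exprn_ge0// hat_ge0.
Qed.

End smooth_test_functions.

Section heat_positivity.
Context (R : realType).
Let mu := @lebesgue_measure R.

(** The background solution starts from a bump that is positive on [-3, 3]. *)
Definition background : R -> R -> R := heat (derivatives (hat 16)) 0.

Lemma background_test : test_function (derivatives (hat (16 : R))).
Proof. by apply: hat_test; lra. Qed.

Lemma background_ge0 t x : 0 <= background t x.
Proof.
by apply: Rintegral_ge0 => y _; rewrite mulr_ge0 ?gauss_fun_ge0// hat_ge0.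
Qed.

Lemma background0 x : background 0 x = gmean (cst 1) * hat 16 x.
Proof.
rewrite /background /heat /dilate_mean sqrtr0 mulr0.
rewrite mulrC -gmeanZ; last first.
  by split=> //; exists 1 => y; rewrite normr1 mul1r lerDl sqr_ge0.
by congr gmean; apply/funext => y; rewrite mul0r addr0 mulr1.
Qed.

(** For y in [-1, 1] the point x + 2 sqrt t y stays in [-3, 3], where the bump
is at least flat 0 7, and the Gaussian weight is at least exp (-1). *)
Lemma background_gt0 : exists2 c, 0 < c & forall t x, 0 <= t <= 1 -> `|x| <= 1 ->
  c <= background t x.
Proof.
pose c : R := expR (- 1) * flat 0 7.
have c0 : 0 < c by rewrite mulr_gt0 ?expR_gt0// flat_gt0.
exists (c * 2); first by rewrite mulr_gt0.
move=> t x /andP[t0 t1] x1; rewrite /background /heat /dilate_mean /gmean.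
have -> : c * 2 = \int[mu]_y ((cst c \_ `[-1, 1]) y).
  rewrite -Rintegral_mkcond Rintegral_cst//= lebesgue_measure_itv/=.
  rewrite lte_fin ifT; last by lra.
  by rewrite -EFinD /=; congr (_ * _); ring.
apply: le_Rintegral => //.
- rewrite -restrict_EFin; apply/integrable_restrict => //=; rewrite setTI.
  apply: continuous_compact_integrable; first exact: segment_compact.
  by apply: continuous_subspaceT => y; exact: cvg_cst.
- apply: integrable_gmean; exact: test_subquadratic background_test _ _ _.
move=> y _; rewrite patchE; case: ifPn => [|_]; last first.
  by rewrite mulr_ge0 ?gauss_fun_ge0// hat_ge0.
rewrite inE/= in_itv/= => /andP[y1 y2]; rewrite ler_pM ?expR_ge0 ?flat_ge0//.
  by rewrite ler_expR lerN2; nra.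
have s1 : Num.sqrt t <= 1 by rewrite -[leRHS]sqrtr1 ler_wsqrtr.
have s0 := sqrtr_ge0 t.
apply: flat0_homo; move: x1; rewrite ler_norml => /andP[x1 x2].
have a1 : Num.sqrt t * y <= 1 by nra.
have a2 : - 1 <= Num.sqrt t * y by nra.
rewrite -mulrA; set a := Num.sqrt t * y in a1 a2 *.
have z1 : x + 2 * a <= 3 by lra.
have z2 : - 3 <= x + 2 * a by lra.
by nra.
Qed.

End heat_positivity.

(** * The concentrating density and its drift *)

Lemma is_derive_congr (R : realType) (f g : R -> R) (x l m : R) :
  is_derive x 1 f l -> f =1 g -> l = m -> is_derive x 1 g m.
Proof. by move=> fD /funext <- <-. Qed.

Section tensor_products.
Context (R : realType) (d : nat).
Implicit Types (G : R -> R) (x : 'rV[R]_d) (i : 'I_d).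

Definition tensor G x : R := \prod_i G (x ord0 i).

(** The product in which the factor of index i is replaced by N: all first order
derivatives of tensor products have this form. *)
Definition tensor_at i (N G : R -> R) x : R :=
  N (x ord0 i) * \prod_(j | j != i) G (x ord0 j).

Lemma tensorE i G x : tensor G x = tensor_at i G G x.
Proof. by rewrite /tensor (bigD1 i). Qed.

Lemma is_derive_tensor_at i N (N' : R) G x :
  is_derive (x ord0 i) 1 N N' ->
  is_derive x (delta_mx ord0 i) (tensor_at i N G)
    (N' * \prod_(j | j != i) G (x ord0 j)).
Proof.
move=> /is_derive_withinT ND; apply/is_derive_withinT; move: ND.
rewrite /has_derive_within !increments_setT => ND.
rewrite (_ : difference_quotient _ _ _ = fun h =>
  difference_quotient N 1 (x ord0 i) h * \prod_(j | j != i) G (x ord0 j)).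
  by apply: cvgM => //; exact: cvg_cst.
apply/funext => h; rewrite /difference_quotient /tensor_at !mxE !eqxx /=.
under eq_bigr => j ji do rewrite !mxE (negbTE ji) andbF mulr0 add0r.
by rewrite -mulrBl -scalerAl.
Qed.

Lemma is_derive_tensor i G (G' : R) x : is_derive (x ord0 i) 1 G G' ->
  is_derive x (delta_mx ord0 i) (tensor G)
    (G' * \prod_(j | j != i) G (x ord0 j)).
Proof.
move=> GD; rewrite (_ : tensor G = tensor_at i G G).
  exact: is_derive_tensor_at.
by apply/funext => y; exact: tensorE.
Qed.

Lemma time_derive_tensor (A : set R) (G : R -> R -> R) (G' : R -> R) t x :
  (forall z, has_derive_within A (G ^~ z) 1 t (G' z)) ->
  has_derive_within A (fun s => tensor (G s) x) 1 t
    (\sum_i tensor_at i G' (G t) x).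
Proof.
move=> GD.
have := @has_derive_within_prod R R _ (index_enum 'I_d) A
  (fun i s => G s (x ord0 i)) (fun i => G' (x ord0 i)) 1 t (index_enum_uniq _).
by apply => i; exact: GD.
Qed.

Lemma tensor_ge0 G x : (forall z, 0 <= G z) -> 0 <= tensor G x.
Proof. by move=> G0; exact: prodr_ge0. Qed.

End tensor_products.

Section concentrating_solution.
Context (R : realType) (m : nat) (m_gt0 : (0 < m)%N).
Local Notation psi := (derivatives (@profile R m)).

Let psiD k (z : R) : is_derive z 1 (psi k) (psi k.+1 z).
Proof. exact: test_derive (profile_test R m_gt0) k z. Qed.

(** The integral over z does not depend on t, and the width is proportional to
1 / lam t. *)
Definition spike (t z : R) : R := lam t * psi 0 (lam t * z).

Definition spike_z (t z : R) : R := lam t ^+ 2 * psi 1 (lam t * z).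

Definition spike_zz (t z : R) : R := lam t ^+ 3 * psi 2 (lam t * z).

Definition spike_t (t z : R) : R :=
  lam t ^+ 3 / 2 * (psi 0 (lam t * z) + lam t * z * psi 1 (lam t * z)).

(** The flux whose divergence makes up for the defect of the spike in the
heat equation: the derivative of spike in time is the derivative in z of
lam^2 / 2 * z * spike, because lam' = lam^3 / 2. *)
Definition spike_flux (t z : R) : R :=
  spike_z t z - lam t ^+ 2 / 2 * (z * spike t z).

Lemma is_derive_psi_scaled k (a z : R) :
  is_derive z 1 (fun z => psi k (a * z)) (psi k.+1 (a * z) * a).
Proof.
apply: (@is_derive1_comp R (psi k) (fun z => a * z)); first exact: psiD.
have := is_deriveZ a (is_derive_id z 1).
by move=> /is_derive_congr; apply=> //; rewrite /GRing.scale /= mulr1.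
Qed.

Lemma is_derive_spike t (z : R) : is_derive z 1 (spike t) (spike_z t z).
Proof.
have := is_deriveZ (lam t) (is_derive_psi_scaled 0 (lam t) z).
by move=> /is_derive_congr; apply=> //; rewrite /spike_z /GRing.scale /=; ring.
Qed.

Lemma is_derive_spike_z t (z : R) : is_derive z 1 (spike_z t) (spike_zz t z).
Proof.
have := is_deriveZ (lam t ^+ 2) (is_derive_psi_scaled 1 (lam t) z).
by move=> /is_derive_congr; apply=> //; rewrite /spike_zz /GRing.scale /=; ring.
Qed.

Lemma is_derive_spike_flux t (z : R) :
  is_derive z 1 (spike_flux t) (spike_zz t z - spike_t t z).
Proof.
have Dzs : is_derive z 1 (fun z => z * spike t z) (z * spike_z t z + spike t z).
  have := is_deriveM (is_derive_id z 1) (is_derive_spike t z).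
  by move=> /is_derive_congr; apply=> //; rewrite /GRing.scale /= mulr1.
have := is_deriveB (is_derive_spike_z t z)
  (is_deriveZ (lam t ^+ 2 / 2) Dzs).
move=> /is_derive_congr; apply=> //.
by rewrite /spike_zz /spike_t /spike /spike_z /GRing.scale /=; field.
Qed.

Lemma is_derive_spike_time (t z : R) : t < 1 ->
  is_derive t 1 (spike ^~ z) (spike_t t z).
Proof.
move=> t1; have lD := is_derive_lam t1.
have lzD : is_derive t 1 (fun t => lam t * z) (lam t ^+ 3 / 2 * z).
  have := is_deriveM lD (is_derive_cst z t 1).
  by move=> /is_derive_congr; apply=> //; rewrite /GRing.scale /=; ring.
have pD := @is_derive1_comp R (psi 0) (fun t => lam t * z) t _ _
  (psiD 0 (lam t * z)) lzD.
have := is_deriveM lD pD.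
move=> /is_derive_congr; apply=> //.
by rewrite /spike_t /GRing.scale /=; field.
Qed.

Lemma spike_ge0 t z : 0 <= spike t z.
Proof. by rewrite mulr_ge0 ?profile_ge0// invr_ge0 sqrtr_ge0. Qed.

Lemma psi_lam_eq0 k t z : 0 <= t < 1 -> 1 < `|z| -> psi k (lam t * z) = 0.
Proof.
move=> t01 z1; apply: profile_eq0 => //; have l1 := lam_ge1 t01.
by rewrite normrM (lt_le_trans z1)// ler_peMl// ger0_norm// (le_trans ler01).
Qed.

Lemma spike_eq0 t z : 0 <= t < 1 -> 1 < `|z| -> spike t z = 0.
Proof. by move=> t01 z1; rewrite /spike psi_lam_eq0// mulr0. Qed.

Lemma spike_flux_eq0 t z : 0 <= t < 1 -> 1 < `|z| -> spike_flux t z = 0.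
Proof.
by move=> t01 z1; rewrite /spike_flux /spike_z spike_eq0// psi_lam_eq0// !mulr0 subrr.
Qed.

Context (d : nat).

Definition density (t : R) (x : 'rV[R]_d) : R :=
  tensor (background t) x + tensor (spike t) x.

(** Vanishes on the unit cube, where the flux lives, and is positive outside,
where the background is not bounded below. *)
Definition wall (x : 'rV[R]_d) : R := \sum_i flat 0 (x ord0 i ^+ 2 - 1).

Definition drift (t : R) (x : 'rV[R]_d) : 'rV[R]_d :=
  \row_i (tensor_at i (spike_flux t) (spike t) x / (density t x + wall x)).

Lemma wall_ge0 x : 0 <= wall x.
Proof. by apply: sumr_ge0 => i _; exact: flat_ge0. Qed.

Lemma density_ge_background t x : tensor (background t) x <= density t x.
Proof. by rewrite lerDl tensor_ge0// => z; exact: spike_ge0. Qed.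

Lemma density_ge_spike t x : tensor (spike t) x <= density t x.
Proof. by rewrite lerDr tensor_ge0// => z; exact: background_ge0. Qed.

Lemma in_cubeVout (x : 'rV[R]_d) :
  (forall i, `|x ord0 i| <= 1) \/ exists i, 1 < `|x ord0 i|.
Proof.
have [|] := boolP [forall i, `|x ord0 i| <= 1].
  by move=> /forallP; left.
rewrite negb_forall => /existsP[i]; rewrite -ltNge; right; by exists i.
Qed.

(** On the unit cube the background is positive, outside the wall is. *)
Lemma density_wall_gt0 t x : 0 <= t < 1 -> 0 < density t x + wall x.
Proof.
move=> /andP[t0 t1].
have u0 : 0 <= density t x.
  apply: le_trans (density_ge_spike _ _); apply: tensor_ge0 => z.
  exact: spike_ge0.
have [xin|[i xi]] := in_cubeVout x.
  rewrite ltr_pwDl ?wall_ge0// (lt_le_trans _ (density_ge_background _ _))//.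
  have [c c0 Hc] := background_gt0 R.
  apply: prodr_gt0 => i _; apply: (lt_le_trans c0).
  by apply: Hc => //; rewrite t0 ltW.
rewrite ltr_wpDl// /wall (bigD1 i)//= ltr_pwDl//.
  apply: flat_gt0; rewrite subr_gt0 -[_ ^+ 2]real_normK ?num_real//.
  by rewrite -[ltLHS](expr1n _ 2) ltr_sqr ?nnegrE.
by apply: sumr_ge0 => j _; exact: flat_ge0.
Qed.

(** Where the flux does not vanish, all coordinates lie in [-1, 1], so that the
wall vanishes and the division is exact. *)
Lemma density_drift t x : 0 <= t < 1 ->
  density t x *: drift t x = \row_i tensor_at i (spike_flux t) (spike t) x.
Proof.
move=> t01; apply/rowP => i; rewrite !mxE.
have [xin|[j xj]] := in_cubeVout x.
  have w0 : wall x = 0.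
    apply: big1 => j _; rewrite flat_eq0// subr_le0.
    by rewrite -[_ ^+ 2]real_normK ?num_real// expr_le1.
  have := density_wall_gt0 x t01; rewrite w0 addr0 => u0.
  by rewrite mulrC divfK// gt_eqF.
suff -> : tensor_at i (spike_flux t) (spike t) x = 0 by rewrite mul0r mulr0.
rewrite /tensor_at; have [->|ji] := eqVneq i j.
  by rewrite spike_flux_eq0// mul0r.
by rewrite (bigD1 j) 1?eq_sym//= spike_eq0// mul0r mulr0.
Qed.

(** Time derivatives relative to [0, 1) are directional derivatives relative to
[0, 1) x R in the direction (1, 0). *)
Lemma has_derive_within_background t z : 0 <= t < 1 ->
  has_derive_within (`[0, 1[ : set R) (fun s : R => background s z) 1 t
    (heat (derivatives (hat 16)) 2 t z).
Proof.
move=> t01; pose y : R * 'rV[R]_1 := (t, \row_(_ < 1) z).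
have yT : @time_space R 1 y by split=> //=; rewrite in_itv.
have := @has_derive_within_heat _ _ (background_test R) 1 0 ord0 (1, 0) y yT.
rewrite !mxE mul1r mul0r addr0 /=.
rewrite /has_derive_within (_ : difference_quotient _ _ _ =
   difference_quotient (fun s : R => background s z) 1 t); last first.
  by apply/funext => h; rewrite /difference_quotient /= !mxE mulr0 add0r.
rewrite (_ : increments _ _ _ = increments (`[0, 1[ : set R) 1 t)//.
rewrite /increments (_ : [set h | time_space _] =
  [set h : R | `[0, 1[%classic (h *: 1 + t)])//.
by apply/seteqP; split=> h //= [].
Qed.

Lemma density_time_derive t x : 0 <= t < 1 ->
  derive_within (`[0, 1[ : set R) (density ^~ x) 1 t =
  \sum_i (tensor_at i (heat (derivatives (hat 16)) 2 t) (background t) x +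
          tensor_at i (spike_t t) (spike t) x).
Proof.
move=> t01; apply/cvg_lim => //; first exact: increments_time_proper.
rewrite big_split; apply: has_derive_withinD; apply: time_derive_tensor => z.
  exact: has_derive_within_background.
have /andP[_ t1] := t01.
have /is_derive_withinT := is_derive_spike_time z t1.
by rewrite /has_derive_within increments_setT; exact: cvg_within_filter.
Qed.

Lemma density_laplacian t x :
  laplacian (density t) x =
  \sum_i (tensor_at i (heat (derivatives (hat 16)) 2 t) (background t) x +
          tensor_at i (spike_zz t) (spike t) x).
Proof.
apply: eq_bigr => i _; rewrite /partial.
have -> : 'D_(delta_mx ord0 i) (density t) =
    tensor_at i (heat (derivatives (hat 16)) 1 t) (background t) \+
    tensor_at i (spike_z t) (spike t).
  apply/funext => y.
  have Db := is_derive_tensor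
    (is_derive_heat_space (background_test R) 0 t (y ord0 i)).
  have Ds := is_derive_tensor (is_derive_spike t (y ord0 i)).
  by have [_ ->] := is_deriveD Db Ds.
have Db := is_derive_tensor_at (background t)
  (is_derive_heat_space (background_test R) 1 t (x ord0 i)).
have Ds := is_derive_tensor_at (spike t) (is_derive_spike_z t (x ord0 i)).
by have [_ ->] := is_deriveD Db Ds.
Qed.

(** In one dimension the background solves the heat equation and the spike
satisfies spike_t = spike_zz - (spike_flux)'. Summing over the factors of the
tensor products gives the equation, since density times drift is the flux. *)
Lemma density_cauchy : cauchy_problem drift density (density 0).
Proof.
split=> // t x t01; rewrite density_time_derive// density_laplacian.
rewrite /div -big_split; apply: eq_bigr => i _ /=; rewrite /partial.
have -> : (fun y => (density t y *: drift t y) ord0 i) =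
    tensor_at i (spike_flux t) (spike t).
  by apply/funext => y; rewrite density_drift// mxE.
have [_ ->] := is_derive_tensor_at (spike t) (is_derive_spike_flux t (x ord0 i)).
by rewrite /tensor_at; ring.
Qed.

Local Notation TS := (@time_space R d).

Lemma Ck_lam_time n : Ck TS n (fun z => lam z.1).
Proof.
apply: (@Ck_lam R _ _ n fst) => [z [/= /[!in_itv]/= /andP[]]//|].
exact: Ck_time.
Qed.

Lemma Ck_psi_scaled n k i : Ck TS n (fun z => psi k (lam z.1 * z.2 ord0 i)).
Proof.
apply: (Ck_test k (profile_test R m_gt0)).
by apply: CkM; [exact: Ck_lam_time|exact: Ck_space].
Qed.

Lemma Ck_spike n i : Ck TS n (fun z => spike z.1 (z.2 ord0 i)).
Proof. by apply: CkM; [exact: Ck_lam_time|exact: Ck_psi_scaled]. Qed.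

Lemma Ck_spike_flux n i : Ck TS n (fun z => spike_flux z.1 (z.2 ord0 i)).
Proof.
apply: CkB; apply: CkM.
- by apply: CkX; exact: Ck_lam_time.
- exact: Ck_psi_scaled.
- by apply: CkM; [apply: CkX; exact: Ck_lam_time|exact: Ck_cst].
- by apply: CkM; [exact: Ck_space|exact: Ck_spike].
Qed.

Lemma Ck_density n : Ck TS n (fun z => density z.1 z.2).
Proof.
apply: CkD; apply: Ck_prod => i; last exact: Ck_spike.
exact: Ck_heat (background_test R) _ _ _ _.
Qed.

Lemma density_smooth : smooth_on TS (fun z => density z.1 z.2).
Proof.
apply: Ck_smooth_on; last exact: Ck_density.
by move=> v z zT; exact: increments_time_space_proper.
Qed.

Lemma drift_smooth : smooth_on TS (fun z => drift z.1 z.2).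
Proof.
apply: Ck_smooth_on => [v z zT|n]; first exact: increments_time_space_proper.
apply: Ck_rV => i; under eq_fun do rewrite mxE.
apply: CkM.
  apply: CkM; first exact: Ck_spike_flux.
  by apply: Ck_prod => j; exact: Ck_spike.
apply: CkV => [z [/= /[!in_itv]/= t01 _]|].
  by rewrite gt_eqF// density_wall_gt0.
apply: CkD; first exact: Ck_density.
apply: Ck_sum => j.
apply: (@Ck_flat _ _ _ _ (fun z : R * 'rV[R]_d => z.2 ord0 j ^+ 2 - 1)).
by apply: CkB; [apply: CkX; exact: Ck_space|exact: Ck_cst].
Qed.

Lemma initial_smooth : smooth_on setT (density 0).
Proof.
apply: Ck_smooth_on => [v z zT|n]; first exact: increments_setT_proper.
apply: CkD; apply: Ck_prod => i.
  under eq_fun do rewrite background0.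
  apply: CkM; first exact: Ck_cst.
  by apply: Ck_hat; exact: Ck_coord.
apply: CkM; first exact: Ck_cst.
apply: (Ck_test 0 (profile_test R m_gt0)).
by apply: CkM; [exact: Ck_cst|exact: Ck_coord].
Qed.

(** At time 0 the background is a multiple of the bump itself. *)
Lemma initial_smooth_compact_support : smooth_compact_support (density 0).
Proof.
split; first exact: initial_smooth.
pose box : set 'rV[R]_d := [set v | forall i, `[-16, 16]%classic (v ord0 i)].
have K : compact box.
  by apply: (@rV_compact R d (fun=> `[-16, 16]%classic)) => _; exact: segment_compact.
have boxc : closed box by apply: compact_closed K; exact: norm_hausdorff.
apply: (subclosed_compact (@closed_closure _ _) K).
rewrite [X in _ `<=` X](closure_id box).1//.
apply: closure_subset => x /= /eqP ux i; rewrite /= ?in_itv /= -ler_norml.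
rewrite leNgt; apply/negP => xi; apply: ux.
rewrite /density !(tensorE i) /tensor_at background0 hat_eq0//; [|lra..].
rewrite spike_eq0 ?lexx ?ltr01//; last by lra.
by rewrite mulr0 !mul0r addr0.
Qed.

End concentrating_solution.

(** * Measurability and bounds on Lebesgue norms *)

Section measurability.
Context (R : realType).
Local Notation mR := (measurableTypeR R).

Lemma measurable_fun_flat0 : measurable_fun setT (flat 0 : mR -> mR).
Proof.
apply: continuous_measurable_fun => x.
exact: is_derive_continuous (is_derive_flat 0 x).
Qed.

Lemma measurable_fun_sqrt : measurable_fun setT (Num.sqrt : mR -> mR).
Proof. by apply: continuous_measurable_fun; exact: sqrt_continuous. Qed.

Lemma measurable_funV_ge0 d (T : measurableType d) (f : T -> mR) :
  (forall x, 0 <= f x) -> measurable_fun setT f ->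
  measurable_fun setT (fun x => (f x)^-1).
Proof.
move=> f0 mf; rewrite (_ : (fun x => _) = (powR (R:=R) ^~ (-1)) \o f).
  by apply: measurableT_comp => //; exact: measurable_powR.
by apply/funext => x /=; rewrite powR_inv1.
Qed.

Lemma measurable_fun_lam : measurable_fun setT (@lam R : mR -> mR).
Proof.
apply: measurable_funV_ge0 => [x|]; first exact: sqrtr_ge0.
apply: measurableT_comp; first exact: measurable_fun_sqrt.
exact: measurable_funB.
Qed.

(** A parameter integral of a nonnegative jointly measurable function, hence
measurable by Tonelli. *)
Lemma measurable_fun_background :
  measurable_fun setT (fun z : mR * mR => background z.1 z.2 : mR).
Proof.
pose f (w : (mR * mR) * mR) : \bar R :=
  (gauss_fun w.2 * hat 16 (w.1.2 + 2 * Num.sqrt w.1.1 * w.2))%:E.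
have mf : measurable_fun setT f.
  apply/measurable_EFinP; apply: measurable_funM.
    by apply: measurableT_comp => //; exact: measurable_gauss_fun.
  apply: measurableT_comp; first exact: test_measurable (background_test R) 0.
  apply: measurable_funD.
    exact: (measurableT_comp measurable_snd measurable_fst).
  apply: measurable_funM => //; apply: measurable_funM => //.
  apply: measurableT_comp; first exact: measurable_fun_sqrt.
  exact: (measurableT_comp measurable_fst measurable_fst).
have f0 w : (0 <= f w)%E.
  by rewrite lee_fin mulr_ge0 ?gauss_fun_ge0 ?hat_ge0.
have := @measurable_fun_fubini_tonelli_F _ _ _ _ R (@lebesgue_measure R) f mf f0.
move=> mF; rewrite (_ : (fun z => _) = fine \o
   fubini_F (@lebesgue_measure R) f)//.
exact: measurableT_comp mF.
Qed.

Context (m : nat) (m_gt0 : (0 < m)%N) (d : nat).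
Local Notation psi := (derivatives (@profile R m)).
Local Notation space := (mR * 'rV[R]_d)%type.

Let measurable_space_coord (i : 'I_d) :
  measurable_fun setT (fun z : space => z.2 ord0 i : mR).
Proof. exact: (measurableT_comp (measurable_coord i) measurable_snd). Qed.

Let measurable_lam_time : measurable_fun setT (fun z : space => lam z.1 : mR).
Proof. exact: (measurableT_comp measurable_fun_lam measurable_fst). Qed.

Let measurable_psi k (i : 'I_d) :
  measurable_fun setT (fun z : space => psi k (lam z.1 * z.2 ord0 i) : mR).
Proof.
apply: (@measurableT_comp _ _ _ _ _ _ (psi k : mR -> mR)).
  exact: test_measurable (profile_test R m_gt0) k.
apply: measurable_funM; first exact: measurable_lam_time.
exact: measurable_space_coord.
Qed.

Let measurable_spike (i : 'I_d) :
  measurable_fun setT (fun z : space => spike m z.1 (z.2 ord0 i) : mR).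
Proof. by apply: measurable_funM => //; exact: measurable_psi. Qed.

Lemma measurable_density :
  measurable_fun setT (fun z : space => density m z.1 z.2 : mR).
Proof.
apply: measurable_funD; apply: measurable_prod => i _.
  have mti : measurable_fun setT (fun z : space => (z.1, z.2 ord0 i)).
    have mt : measurable_fun setT (fun z : space => z.1 : mR).
      exact: measurable_fst.
    by apply/measurable_fun_pairP; split; [exact: mt|exact: measurable_space_coord].
  exact: (measurableT_comp measurable_fun_background mti).
exact: measurable_spike.
Qed.

(** The denominator is nonnegative for all t, also outside [0, 1), so that its
inverse is a real power. *)
Lemma measurable_drift :
  measurable_fun setT (fun z : space => drift m z.1 z.2).
Proof.
apply: measurable_fun_rV => i; under eq_fun do rewrite mxE.
apply: measurable_funM.
  apply: measurable_funM; last first.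
    under eq_fun do rewrite -big_filter.
    by apply: measurable_prod => j _; exact: measurable_spike.
  apply: measurable_funB; apply: measurable_funM.
  - exact: measurable_funX.
  - exact: measurable_psi.
  - by apply: measurable_funM => //; exact: measurable_funX.
  - apply: measurable_funM; last exact: measurable_spike.
    exact: measurable_space_coord.
apply: measurable_funV_ge0 => [z|].
  apply: addr_ge0 (wall_ge0 _); apply: le_trans (density_ge_spike _ _ _).
  by apply: tensor_ge0 => y; exact: spike_ge0.
apply: measurable_funD; first exact: measurable_density.
apply: measurable_sum => j.
apply: measurableT_comp; first exact: measurable_fun_flat0.
apply: measurable_funB => //; apply: measurable_funX.
exact: measurable_space_coord.
Qed.

End measurability.

Section Lnorm_bounds.
Context d (T : measurableType d) (R : realType) (mu : {measure set T -> \bar R}).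
Local Open Scope ereal_scope.

(** In this bound and the next one the exponent 1/p is 0 for p = +oo, so that
both cases have the same form. *)
Lemma Lnorm_ge (p : \bar R) (f : T -> \bar R) (Q : set T) (c q : R) :
  1 <= p -> measurable_fun setT f -> measurable Q -> mu Q = q%:E ->
  (0 < q)%R -> (0 <= c)%R -> (forall x, Q x -> c%:E <= `|f x|) ->
  (c * q `^ fine p^-1)%:E <= Lnorm mu p f.
Proof.
move=> p1 mf mQ Qq q0 c0 Hf; rewrite unlock; case: p p1 => [r| |]//.
- rewrite lee_fin => r1; have r0 : (0 < r)%R by rewrite (lt_le_trans ltr01).
  rewrite inver (negbTE (lt0r_neq0 r0)) /=.
  have mfr : measurable_fun setT (fun x => `|f x| `^ r).
    by apply: (measurableT_comp (measurable_poweR r)); exact: measurableT_comp.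
  have I : (c `^ r * q)%:E <= \int[mu]_x (`|f x| `^ r).
    apply: (@le_trans _ _ (\int[mu]_(x in Q) (`|f x| `^ r))).
      rewrite EFinM -Qq -(integral_cst _ mQ) ge0_le_integral//.
      - by move=> x _; rewrite lee_fin powR_ge0.
      - exact: measurable_funTS.
      - move=> x Qx; rewrite -poweR_EFin; apply: gt0_ler_poweR => //.
        + exact: ltW.
        + by rewrite in_itv/= lee_fin c0 leey.
        + by rewrite in_itv/= abse_ge0 leey.
        + exact: Hf.
    apply: ge0_subset_integral => //; by move=> x _; exact: poweR_ge0.
  have -> : (c * q `^ r^-1)%:E = (c `^ r * q)%:E `^ r^-1.
    rewrite poweR_EFin powRM ?powR_ge0 ?ltW// -powRrM mulfV ?gt_eqF//.
    by rewrite powRr1.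
  apply: gt0_ler_poweR => //.
  + by rewrite invr_ge0 ltW.
  + by rewrite in_itv/= lee_fin mulr_ge0 ?powR_ge0 ?(ltW q0)// leey.
  + by rewrite in_itv/= leey andbT integral_ge0// => x _; exact: poweR_ge0.
- move=> _; rewrite invey /= powRr0 mulr1.
  have Q0 : 0 < mu Q by rewrite Qq lte_fin.
  have T0 : 0 < mu setT by rewrite (lt_le_trans Q0)// le_measure ?inE.
  rewrite T0 leNgt; apply/negP => fc.
  have [N [mN N0 HN]] := ess_sup_ge mu (abse \o f).
  have : mu Q <= mu N.
    apply: le_measure; rewrite ?inE// => x Qx; apply: HN => /= fx.
    by have := le_lt_trans fx fc; rewrite ltNge Hf.
  by rewrite N0 leNgt Q0.
Qed.

Lemma Lnorm_le (p : \bar R) (f : T -> \bar R) (Q : set T) (c q : R) :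
  1 <= p -> measurable_fun setT f -> measurable Q -> mu Q = q%:E ->
  (0 <= c)%R -> (forall x, Q x -> `|f x| <= c%:E) ->
  (forall x, ~ Q x -> f x = 0) ->
  Lnorm mu p f <= (c * q `^ fine p^-1)%:E.
Proof.
move=> p1 mf mQ Qq c0 Hf f0; rewrite unlock; case: p p1 => [r| |]//.
- rewrite lee_fin => r1; have r0 : (0 < r)%R by rewrite (lt_le_trans ltr01).
  have q0 : (0 <= q)%R by rewrite -lee_fin -Qq.
  rewrite inver (negbTE (lt0r_neq0 r0)) /=.
  have mfr : measurable_fun setT (fun x => `|f x| `^ r).
    by apply: (measurableT_comp (measurable_poweR r)); exact: measurableT_comp.
  have I : \int[mu]_x (`|f x| `^ r) <= (c `^ r * q)%:E.
    rewrite (_ : \int[mu]_x _ = \int[mu]_(x in Q) (`|f x| `^ r)).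
      rewrite EFinM -Qq -(integral_cst _ mQ) ge0_le_integral//.
      - by move=> x _; exact: poweR_ge0.
      - exact: measurable_funTS.
      - move=> x Qx; rewrite -poweR_EFin; apply: gt0_ler_poweR => //.
        + exact: ltW.
        + by rewrite in_itv/= abse_ge0 leey.
        + by rewrite in_itv/= lee_fin c0 leey.
        + exact: Hf.
    rewrite [RHS]integral_mkcond; apply: eq_integral => x _.
    rewrite patchE; case: ifPn => //; rewrite notin_setE => /f0 ->.
    by rewrite abse0 poweR0r// gt_eqF.
  have -> : (c * q `^ r^-1)%:E = (c `^ r * q)%:E `^ r^-1.
    rewrite poweR_EFin powRM ?powR_ge0// -powRrM mulfV ?gt_eqF//.
    by rewrite powRr1.
  apply: gt0_ler_poweR => //.
  + by rewrite invr_ge0 ltW.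
  + by rewrite in_itv/= leey andbT integral_ge0// => x _; exact: poweR_ge0.
  + by rewrite in_itv/= lee_fin mulr_ge0 ?powR_ge0 ?q0// leey.
- move=> _; rewrite invey /= powRr0 mulr1.
  case: ifPn => _; last by rewrite lee_fin.
  apply/ess_supP; apply: nearW => x /=.
  have [Qx|/f0 ->] := pselect (Q x); first exact: Hf.
  by rewrite abse0 lee_fin.
Qed.

End Lnorm_bounds.

(** * Concentration on shrinking cubes *)

Section cubes.
Context (R : realType) (d : nat).

Definition cube (s : R) : set 'rV[R]_d := [set x | forall i, `|x ord0 i| <= s].

Lemma cubeE s : cube s = [set x | forall i, `[- s, s]%classic (x ord0 i)].
Proof.
by apply/seteqP; split=> x /= h i; have := h i; rewrite in_itv/= -ler_norml.
Qed.

Lemma measurable_cube s : measurable (cube s).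
Proof.
rewrite (_ : cube s = \bigcap_(i in [set: 'I_d])
    ((fun v : 'rV[R]_d => v ord0 i : measurableTypeR R) @^-1` `[- s, s])).
  apply: fin_bigcap_measurable => [|i _]; first exact: finite_finset.
  by rewrite -[X in measurable X]setTI; exact: measurable_coord.
by rewrite cubeE; apply/seteqP; split=> v /= h i; [move=> _|]; exact: h.
Qed.

Lemma lebesgue_cube s : 0 < s -> lebesgue_rV R d (cube s) = ((2 * s) ^+ d)%:E.
Proof.
move=> s0; rewrite cubeE (@lebesgue_rV_box R d (fun=> `[- s, s]%classic))//.
under eq_bigr => i _.
  rewrite lebesgue_measure_itv/= lte_fin ifT; last by lra.
  rewrite -EFinD (_ : s - - s = 2 * s); last by ring.
  over.
by rewrite prodEFin prodr_const card_ord.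
Qed.

End cubes.

Section concentration.
Context (R : realType) (d m : nat) (d_gt0 : (0 < d)%N).
Local Open Scope ereal_scope.

(** On [-1/2, 1/2] the bump is at least flat 0 (3/4). *)
Lemma spike_ge : exists2 k : R, (0 < k)%R & forall t (x : 'rV[R]_d),
  (0 <= t < 1)%R -> cube (2 * lam t)^-1 x ->
  ((k * lam t) ^+ d <= tensor (spike m t) x)%R.
Proof.
pose k : R := (flat 0 (3 / 4) ^+ m)%R.
have k0 : (0 < k)%R by rewrite exprn_gt0// flat_gt0//; lra.
exists k => // t x /andP[_ t1] xc; have l0 := lam_gt0 t1.
rewrite -[X in (_ ^+ X)%R]card_ord -prodr_const; apply: ler_prod => i _.
rewrite mulr_ge0 ?(ltW k0) ?(ltW l0)//= mulrC ler_wpM2l ?(ltW l0)//.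
rewrite /derivatives /= /profile; apply: lerXn2r; rewrite ?nnegrE ?flat_ge0//; apply: flat0_homo.
have := xc i; rewrite invfM ler_pdivlMr// mulrC.
rewrite -{1}(gtr0_norm l0) -normrM ler_norml => /andP[].
set y := (lam t * _)%R => y1 y2; nra.
Qed.

Lemma lebesgue_spike_cube t : (0 <= t < 1)%R ->
  lebesgue_rV R d (cube (2 * lam t)^-1) = ((lam t)^-1 ^+ d)%:E.
Proof.
move=> /andP[_ t1]; have l0 := lam_gt0 t1.
rewrite lebesgue_cube ?invr_gt0 ?mulr_gt0//; congr (_ ^+ d)%:E.
by field; rewrite gt_eqF.
Qed.

Lemma density_ge0 t (x : 'rV[R]_d) : (0 <= density m t x)%R.
Proof.
apply: le_trans (density_ge_spike m t x); apply: tensor_ge0 => z.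
exact: spike_ge0.
Qed.

(** lam t >= c as soon as 1 - t <= c^-2. *)
Lemma lam_large (b : R) : \forall t \near (1 : R)^'-, (b <= lam t)%R.
Proof.
pose c : R := (`|b| + 1)%R; have c0 : (0 < c)%R by rewrite ltr_wpDl.
near=> t.
have t1 : (t < 1)%R by near: t; exact: nbhs_left_lt.
have tc : (1 - (c ^- 2) < t)%R.
  by near: t; apply: nbhs_left_gt; rewrite ltrBlDr ltrDl invr_gt0 exprn_gt0.
have s0 : (0 < Num.sqrt (1 - t))%R by rewrite sqrtr_gt0 subr_gt0.
apply: (@le_trans _ _ c); first by rewrite (le_trans (ler_norm _))// /c lerDl.
rewrite /lam -[leLHS]invrK lef_pV2 ?posrE ?invr_gt0//.
have ci0 : (0 <= c^-1)%R by rewrite invr_ge0 ltW.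
rewrite -[leRHS](ger0_norm ci0) -sqrtr_sqr ler_wsqrtr// exprVn.
by move: tc; lra.
Unshelve. all: by end_near. Qed.

Lemma near_1_unit_interval : \forall t \near (1 : R)^'-, (0 <= t < 1)%R.
Proof.
near=> t; apply/andP; split.
  by apply: ltW; near: t; exact: nbhs_left_gt.
by near: t; exact: nbhs_left_lt.
Unshelve. all: by end_near. Qed.

Context (m_gt0 : (0 < m)%N).

Lemma measurable_density_at t :
  measurable_fun setT (fun x : 'rV[R]_d => density m t x : measurableTypeR R).
Proof.
have mp : measurable_fun setT (fun x : 'rV[R]_d => (t, x) : measurableTypeR R * _).
  exact: measurable_pair1.
exact: (measurableT_comp (measurable_density m_gt0 (d := d)) mp).
Qed.

(** The spike puts a mass at least k^d on a cube of volume lam^-d. *)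
Lemma density_not_equi_integrable :
  ~ equi_integrable `[0%R, 1%R[ (@density R m d).
Proof.
have [k k0 Hk] := spike_ge => EI.
have kd0 : (0 < k ^+ d)%R by rewrite exprn_gt0.
have [|e e0 He] := EI (k ^+ d / 2)%R; first by rewrite divr_gt0.
have [t [t01 te]] : exists t : R, (0 <= t < 1 /\ e^-1 + 1 <= lam t)%R.
  have : \forall t \near (1 : R)^'-, (0 <= t < 1 /\ e^-1 + 1 <= lam t)%R.
    by near=> t; split; near: t; [exact: near_1_unit_interval|exact: lam_large].
  by move=> /filter_ex.
have /andP[t0 t1] := t01.
have l0 := lam_gt0 t1; have l1 := lam_ge1 t01.
have mQ := @measurable_cube R d (2 * lam t)^-1.
have small : ((lam t)^-1 ^+ d < e)%R.
  rewrite (@le_lt_trans _ _ (lam t)^-1)%R//.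
    rewrite -[leRHS]expr1 ler_wiXn2l ?invr_ge0 ?(ltW l0)//.
    by rewrite invf_le1.
  by rewrite invf_plt ?posrE// (lt_le_trans _ te)// ltrDl.
have := He t (cube (2 * lam t)^-1); rewrite /= in_itv/= t0 t1 => /(_ erefl mQ).
rewrite lebesgue_spike_cube// lte_fin => /(_ small).
apply/negP; rewrite -ltNge.
apply: (@lt_le_trans _ _ (k ^+ d)%:E); first by rewrite lte_fin; lra.
have -> : (k ^+ d)%:E = ((k * lam t) ^+ d)%:E * lebesgue_rV R d (cube (2 * lam t)^-1).
  rewrite lebesgue_spike_cube// -EFinM -exprMn; congr (_ ^+ d)%:E.
  by field; rewrite gt_eqF.
rewrite -integral_cst// ge0_le_integral//.
- by move=> x _; rewrite lee_fin exprn_ge0// mulr_ge0 ?ltW.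
- apply/measurable_EFinP/measurable_funTS/measurableT_comp => //.
  exact: measurable_density_at.
- move=> x Qx; rewrite lee_fin ger0_norm ?density_ge0//.
  exact: le_trans (Hk t x t01 Qx) (density_ge_spike _ _ _).
Unshelve. all: by end_near. Qed.

Lemma exponent_lt1 (p : \bar R) : 1 < p -> (fine p^-1 < 1)%R.
Proof.
case: p => [r| |]; last 2 first.
- by rewrite invey/= ltr01.
- by rewrite ltNge leNye.
rewrite lte_fin => r1; have r0 : (0 < r)%R by rewrite (lt_trans ltr01).
by rewrite inver (negbTE (lt0r_neq0 r0))/= invf_lt1.
Qed.

(** The same cube gives the lower bound k^d lam^(d (1 - 1/p)). *)
Lemma density_Lnorm_cvgy (p : \bar R) : 1 < p ->
  Lnorm (lebesgue_rV R d) p (EFin \o @density R m d t) @[t --> (1 : R)^'-]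
    --> +oo%E.
Proof.
move=> p1; have [k k0 Hk] := spike_ge.
have kd0 : (0 < k ^+ d)%R by rewrite exprn_gt0.
pose a : R := (1 - fine p^-1)%R.
have a0 : (0 < a)%R by rewrite subr_gt0; exact: exponent_lt1.
apply/cvgeyPge => A.
pose B : R := ((`|A| / k ^+ d) `^ a^-1)%R.
near=> t.
have t01 : (0 <= t < 1)%R by near: t; exact: near_1_unit_interval.
have tB : (B <= lam t)%R by near: t; exact: lam_large.
have /andP[_ t1] := t01; have l0 := lam_gt0 t1; have l1 := lam_ge1 t01.
apply: (@le_trans _ _ ((k * lam t) ^+ d * ((lam t)^-1 ^+ d) `^ fine p^-1)%:E);
    last first.
  apply: Lnorm_ge (@measurable_cube R d (2 * lam t)^-1) _ _ _ _ => //.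
  - exact: ltW.
  - by apply/measurable_EFinP; exact: measurable_density_at.
  - exact: lebesgue_spike_cube.
  - by rewrite exprn_gt0// invr_gt0.
  - by rewrite exprn_ge0// mulr_ge0 ?ltW.
  - move=> x Qx; rewrite /= lee_fin ger0_norm ?density_ge0//.
    exact: le_trans (Hk t x t01 Qx) (density_ge_spike _ _ _).
rewrite lee_fin (le_trans (ler_norm _))//.
have ld0 : (0 < lam t ^+ d)%R by rewrite exprn_gt0.
have -> : ((k * lam t) ^+ d * ((lam t)^-1 ^+ d) `^ fine p^-1 =
    k ^+ d * (lam t ^+ d) `^ a)%R.
  rewrite exprMn -mulrA; congr (_ * _)%R.
  rewrite exprVn -powR_inv1 ?ltW// -powRrM mulN1r.
  rewrite -{1}[(lam t ^+ d)%R]powRr1 ?ltW// -powRD//.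
  by apply/implyP => _; rewrite gt_eqF.
rewrite -ler_pdivrMl// mulrC.
apply: (@le_trans _ _ (lam t `^ a)%R); last first.
  apply: ge0_ler_powR; rewrite ?nnegrE ?(ltW l0) ?(ltW ld0) ?(ltW a0)//.
  by rewrite -[leLHS]expr1 ler_weXn2l.
have A0 : (0 <= `|A| / k ^+ d)%R by rewrite divr_ge0// ltW.
rewrite -[leLHS](powRr1 A0) -(mulVf (lt0r_neq0 a0)) powRrM.
by apply: ge0_ler_powR; rewrite ?nnegrE ?powR_ge0 ?(ltW a0) ?(ltW l0).
Unshelve. all: by end_near. Qed.

End concentration.

(** * Size of the drift *)

Section drift_bound.
Context (R : realType) (d m : nat).
Local Notation psi := (derivatives (@profile R m.+1)).

Lemma norm2_le (v : 'rV[R]_d) M : (forall i, `|v ord0 i| <= M) ->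
  norm2 v <= Num.sqrt d%:R * `|M|.
Proof.
move=> vM; rewrite -sqrtr_sqr -sqrtrM ?ler0n// ler_wsqrtr//.
rewrite mulr_natl -[X in _ *+ X]card_ord -sumr_const; apply: ler_sum => i _.
rewrite -[leLHS]real_normK ?num_real// lerXn2r ?nnegrE//.
exact: le_trans (vM i).
Qed.

Definition profile_product (t : R) (x : 'rV[R]_d) : R :=
  \prod_i hat 1 (lam t * x ord0 i).

Lemma spike_tensorE t x :
  tensor (spike m.+1 t) x = lam t ^+ d * profile_product t x ^+ m.+1.
Proof.
rewrite /profile_product -prodrXl -[X in lam t ^+ X]card_ord -prodr_const.
by rewrite -big_split.
Qed.

Lemma spike_flux_le : exists2 C : R, 0 <= C & forall t z : R, 0 <= t < 1 ->
  `|spike_flux m.+1 t z| <= C * lam t ^+ 2 * hat 1 (lam t * z) ^+ m.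
Proof.
have [C C0 HC] := @profile_derivative_bound R m.
exists (C + 1); first by rewrite addr_ge0.
move=> t z /andP[_ t1]; have l0 := lam_gt0 t1.
have -> : spike_flux m.+1 t z =
    lam t ^+ 2 * (psi 1 (lam t * z) - (lam t * z) / 2 * psi 0 (lam t * z)).
  by rewrite /spike_flux /spike_z /spike; field.
set y := lam t * z; rewrite normrM (ger0_norm (exprn_ge0 _ (ltW l0))).
rewrite [leRHS]mulrAC [leRHS]mulrC ler_wpM2l ?exprn_ge0 ?(ltW l0)//.
rewrite (le_trans (ler_normB _ _))// mulrDl lerD// mul1r.
have [y1|y1] := lerP `|y| 1; last first.
  by rewrite profile_eq0// mulr0 normr0 exprn_ge0// hat_ge0.
rewrite normrM /derivatives /= /profile exprS.
rewrite [`|hat 1 y * _|]ger0_norm ?mulr_ge0 ?exprn_ge0 ?hat_ge0//.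
rewrite mulrA ler_piMl ?exprn_ge0 ?hat_ge0//.
apply: mulr_ile1; rewrite ?normr_ge0 ?hat_ge0 ?hat_le1//.
rewrite normrM [`|2^-1|]ger0_norm ?invr_ge0//; lra.
Qed.

(** With s = lam^(d/(m+1)) X, X the product of the bumps, the spike is s^(m+1)
and the flux is at most lam^(1 + d/(m+1)) s^m up to a constant; so that the
quotient by a quantity of size 1 + s^(m+1) loses only lam^(d/(m+1)). *)
Lemma drift_le : exists2 C : R, 0 <= C & forall (t : R) (x : 'rV[R]_d), 0 <= t < 1 ->
  norm2 (drift m.+1 t x) <= C * lam t `^ (1 + d%:R / m.+1%:R).
Proof.
have [C C0 HC] := spike_flux_le; have [c c0 Hc] := background_gt0 R.
(* e (1 + s^(m+1)) bounds the denominator from below on the unit cube. *)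
pose e := Num.min (c ^+ d) 1.
have e0 : 0 < e by rewrite lt_min exprn_gt0 ?ltr01.
pose K := C / e; have K0 : 0 <= K by rewrite divr_ge0// ltW.
exists (Num.sqrt d%:R * K); first by rewrite mulr_ge0// sqrtr_ge0.
move=> t x t01; have /andP[t0 t1] := t01; have l0 := lam_gt0 t1.
have l1 := lam_ge1 t01.
pose ex := 1 + d%:R / m.+1%:R : R.
have KL0 : 0 <= K * lam t `^ ex by rewrite mulr_ge0 ?powR_ge0.
rewrite -mulrA -[K * _](ger0_norm KL0); apply: norm2_le => i.
rewrite mxE normrM normfV.
have D0 := density_wall_gt0 m.+1 x t01.
rewrite (gtr0_norm D0) ler_pdivrMr//.
have [xin|[j xj]] := in_cubeVout x; last first.
  suff -> : tensor_at i (spike_flux m.+1 t) (spike m.+1 t) x = 0.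
    by rewrite normr0 mulr_ge0 ?(ltW D0).
  rewrite /tensor_at; have [->|ji] := eqVneq i j.
    by rewrite spike_flux_eq0// mul0r.
  by rewrite (bigD1 j) 1?eq_sym//= spike_eq0// mul0r mulr0.
pose X := profile_product t x.
have X0 : 0 <= X by apply: prodr_ge0 => j _; exact: hat_ge0.
pose rho := lam t `^ (d%:R / m.+1%:R).
have rho0 : 0 <= rho by exact: powR_ge0.
have rhom : rho ^+ m.+1 = lam t ^+ d.
  rewrite -powR_mulrn// -powRrM divfK ?pnatr_eq0// powR_mulrn//.
  exact: ltW.
have lex : lam t `^ ex = lam t * rho.
  rewrite /ex powRD; first by rewrite powRr1// ltW.
  by apply/implyP => _; rewrite gt_eqF.
have num : `|tensor_at i (spike_flux m.+1 t) (spike m.+1 t) x| <=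
    C * lam t * (rho * (rho * X) ^+ m).
  have -> : C * lam t * (rho * (rho * X) ^+ m) =
      C * lam t * (lam t ^+ d * X ^+ m).
    by rewrite -rhom exprMn exprS !mulrA.
  rewrite /tensor_at normrM normr_prod.
  apply: (@le_trans _ _ (C * lam t ^+ 2 * hat 1 (lam t * x ord0 i) ^+ m *
    \prod_(j | j != i) (lam t * hat 1 (lam t * x ord0 j) ^+ m))).
    apply: ler_pM => //; [exact: prodr_ge0|exact: HC|].
    apply: ler_prod => j _; rewrite normr_ge0 /= ger0_norm ?spike_ge0//.
    rewrite ler_wpM2l ?(ltW l0)// /derivatives /= /profile exprS.
    by rewrite ler_piMl ?exprn_ge0 ?hat_ge0 ?hat_le1.
  have -> : lam t ^+ d * X ^+ m = \prod_j (lam t * hat 1 (lam t * x ord0 j) ^+ m).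
    rewrite /X /profile_product -prodrXl -[X in lam t ^+ X]card_ord -prodr_const.
    by rewrite -big_split.
  rewrite [X in _ <= _ * X](bigD1 i)//= le_eqVlt; apply/orP; left; apply/eqP.
  by ring.
apply: (le_trans num); rewrite lex /K.
have den : e * (1 + (rho * X) ^+ m.+1) <= density m.+1 t x + wall x.
  rewrite -[leLHS]addr0 lerD ?wall_ge0// /density spike_tensorE -/X exprMn rhom.
  rewrite mulrDr mulr1 lerD//.
    apply: (@le_trans _ _ (c ^+ d)); first by rewrite ge_min lexx.
    rewrite -[X in c ^+ X]card_ord -prodr_const; apply: ler_prod => j _.
    by rewrite (ltW c0)/= Hc// t0 ltW.
  by rewrite ler_piMl ?mulr_ge0 ?exprn_ge0 ?(ltW l0)// ge_min lexx orbT.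
apply: (@le_trans _ _ (C / e * (lam t * rho) * (e * (1 + (rho * X) ^+ m.+1)))).
  have -> : C / e * (lam t * rho) * (e * (1 + (rho * X) ^+ m.+1)) =
      C * lam t * (rho * (1 + (rho * X) ^+ m.+1)).
    by field; rewrite gt_eqF.
  rewrite ler_wpM2l ?mulr_ge0 ?(ltW l0)// ler_wpM2l//.
  have s0 : 0 <= rho * X by rewrite mulr_ge0.
  have [s1|s1] := lerP (rho * X) 1.
    by rewrite (@le_trans _ _ 1)// ?exprn_ile1// lerDl exprn_ge0.
  rewrite exprS (@le_trans _ _ ((rho * X) * (rho * X) ^+ m))// ?lerDr//.
  by rewrite ler_peMl ?exprn_ge0// ltW.
by rewrite ler_wpM2l// mulr_ge0 ?K0// mulr_ge0 ?(ltW l0).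
Qed.

Lemma drift_eq0 t (x : 'rV[R]_d) : 0 <= t < 1 -> ~ cube (lam t)^-1 x ->
  drift m.+1 t x = 0.
Proof.
move=> /andP[_ t1] xout; have l0 := lam_gt0 t1.
have [j xj] : exists j, 1 < `|lam t * x ord0 j|.
  apply: contrapT => H; apply: xout => j; rewrite leNgt; apply/negP => xj.
  apply: H; exists j; rewrite normrM (gtr0_norm l0).
  by rewrite -ltr_pdivrMl// mulr1.
apply/rowP => i; rewrite !mxE /tensor_at.
suff -> : spike_flux m.+1 t (x ord0 i) *
    \prod_(j0 | j0 != i) spike m.+1 t (x ord0 j0) = 0 by rewrite mul0r.
have [->|ji] := eqVneq i j.
  by rewrite /spike_flux /spike_z /spike !profile_eq0// !mulr0 subrr mul0r.
by rewrite (bigD1 j) 1?eq_sym//= /spike profile_eq0// !mulr0 mul0r mulr0.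
Qed.

Local Open Scope ereal_scope.

Lemma measurable_norm2 :
  measurable_fun setT (@norm2 R d : 'rV[R]_d -> measurableTypeR R).
Proof.
apply: measurableT_comp; first exact: measurable_fun_sqrt.
apply: measurable_sum => i; apply: measurable_funX.
exact: measurable_coord.
Qed.

Let measurable_norm2_drift :
  measurable_fun setT (fun z : measurableTypeR R * 'rV[R]_d =>
    norm2 (drift m.+1 z.1 z.2) : measurableTypeR R).
Proof.
exact: (measurableT_comp measurable_norm2 (measurable_drift (ltn0Sn m) (d := d))).
Qed.

Let measurable_norm2_drift_at t :
  measurable_fun setT (fun x : 'rV[R]_d => norm2 (drift m.+1 t x) : measurableTypeR R).
Proof.
have mp : measurable_fun setT (fun x : 'rV[R]_d => (t, x) : measurableTypeR R * _).
  exact: measurable_pair1.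
exact: (measurableT_comp measurable_norm2_drift mp).
Qed.

(** The drift is at most lam^(1 + d/(m+1)), up to a constant, on a cube of volume
(2 / lam)^d, and vanishes outside. *)
Lemma Lq_drift_le q : 1 <= q -> exists2 K : R, (0 <= K)%R & forall t : R, (0 <= t < 1)%R ->
  Lq_norm q (@drift R m.+1 d t) <=
  (K * lam t `^ (1 + d%:R / m.+1%:R - d%:R * fine q^-1))%:E.
Proof.
move=> q1; have [C C0 HC] := drift_le.
pose iq := fine q^-1.
exists (C * 2 `^ (d%:R * iq))%R; first by rewrite mulr_ge0 ?powR_ge0.
move=> t t01; have /andP[_ t1] := t01; have l0 := lam_gt0 t1.
have li0 : (0 < (lam t)^-1)%R by rewrite invr_gt0.
have -> : (C * 2 `^ (d%:R * iq) * lam t `^ (1 + d%:R / m.+1%:R - d%:R * iq) =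
    C * lam t `^ (1 + d%:R / m.+1%:R) * ((2 * (lam t)^-1) ^+ d) `^ iq)%R.
  rewrite -powR_mulrn ?mulr_ge0 ?(ltW li0)// -powRrM powRM ?(ltW li0)//.
  rewrite powRB; last by apply/implyP => _; rewrite gt_eqF.
  rewrite -[((lam t)^-1)%R]powR_inv1 ?(ltW l0)// -powRrM mulN1r powRN.
  by ring.
apply: Lnorm_le (@measurable_cube R d (lam t)^-1) _ _ _ _ => //.
- apply/measurable_EFinP; exact: measurable_norm2_drift_at.
- exact: lebesgue_cube.
- by rewrite mulr_ge0 ?powR_ge0.
- by move=> x _; rewrite /= lee_fin ger0_norm ?sqrtr_ge0//; exact: HC.
- move=> x xout; rewrite drift_eq0// /norm2 big1 ?sqrtr0// => i _.
  by rewrite mxE expr0n.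
Qed.

(** For finite q this is Tonelli. For q = +oo the essential supremum at time t
exceeds a exactly when the section at t of the measurable set where the norm
exceeds a has positive measure. *)
Lemma measurable_Lq_drift q : 1 <= q ->
  measurable_fun setT
    (fun t : measurableTypeR R => Lq_norm q (@drift R m.+1 d t)).
Proof.
case: q => [q| |]; last by rewrite leNgt ltNye.
- move=> _; rewrite /Lq_norm; under eq_fun do rewrite unlock.
  apply: (measurableT_comp (measurable_poweR q^-1)).
  pose f (z : measurableTypeR R * 'rV[R]_d) : \bar R :=
    `|(norm2 (drift m.+1 z.1 z.2))%:E| `^ q.
  have mf : measurable_fun setT f.
    apply: (measurableT_comp (measurable_poweR q)); apply: measurableT_comp => //.
    by apply/measurable_EFinP; exact: measurable_norm2_drift.
  have f0 z : 0 <= f z by exact: poweR_ge0.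
  exact: (@measurable_fun_fubini_tonelli_F _ _ _ _ _ (lebesgue_rV R d) f mf f0).
move=> _; rewrite /Lq_norm.
have [T0|T0] := boolP (0 < lebesgue_rV R d setT); last first.
  under eq_fun do rewrite unlock (negbTE T0).
  exact: measurable_cst.
under eq_fun do rewrite unlock T0.
apply: (measurability _ (ErealGenOInfty.measurableE R)).
move=> /= _ [_ [a ->]] <-; rewrite setTI preimage_itvoy.
pose A : set (measurableTypeR R * 'rV[R]_d) :=
  (fun z => (norm2 (drift m.+1 z.1 z.2))%:E) @^-1` `]a%:E, +oo[.
have mA : measurable A.
  rewrite -[A]setTI.
  have mf : measurable_fun setT (fun z : measurableTypeR R * 'rV[R]_d =>
      (norm2 (drift m.+1 z.1 z.2))%:E).
    by apply/measurable_EFinP; exact: measurable_norm2_drift.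
  by apply: mf => //; exact: emeasurable_itv.
have mx := @measurable_fun_xsection _ _ _ _ _ (lebesgue_rV R d) A mA.
rewrite (_ : [set _ | _] = ~` ((lebesgue_rV R d \o xsection A) @^-1` [set 0])).
  apply: measurableC; rewrite -[X in measurable X]setTI; apply: mx => //.
have key t : (ess_sup (lebesgue_rV R d) (abse \o
    (fun x => (norm2 (drift m.+1 t x))%:E)) <= a%:E) <->
    lebesgue_rV R d (xsection A t) = 0.
  rewrite (_ : xsection A t = (abse \o (fun x => (norm2 (drift m.+1 t x))%:E))
      @^-1` `]a%:E, +oo[); last first.
    apply/seteqP; split=> x; rewrite /xsection /A /= inE /=.
      by rewrite ger0_norm ?sqrtr_ge0.
    by rewrite ger0_norm ?sqrtr_ge0.
  rewrite -ae_le_measureP; first by split=> /ess_supP.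
  apply: measurableT_comp => //.
  by apply/measurable_EFinP; exact: measurable_norm2_drift_at.
apply/seteqP; split => t /=; rewrite ltNge.
- by move=> /negP h /key.
- by move=> h; apply/negP => /key.
Qed.

End drift_bound.

(** * Integrability in time *)

Lemma is_derive_one_minus (R : realType) (t : R) :
  is_derive t 1 (fun t => 1 - t) (- 1).
Proof.
have D := is_deriveB (is_derive_cst (1 : R) t 1) (is_derive_id t 1).
by apply: (is_derive_congr D) => //; rewrite sub0r.
Qed.

Section time_integrability.
Context (R : realType).
Local Notation leb := (@lebesgue_measure R).
Local Open Scope ereal_scope.

(** The fundamental theorem of calculus on [0, 1 - 1/(n+2)], then monotone
convergence. *)
Lemma integral_onem_powR (a : R) : (0 <= a)%R -> (a < 1)%R ->
  \int[leb]_(t in `[0%R, 1%R[) ((1 - t) `^ (- a))%:E <= ((1 - a)^-1)%:E.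
Proof.
move=> a0 a1; have a10 : (0 < 1 - a)%R by rewrite subr_gt0.
pose f (t : R) : R := ((1 - t) `^ (- a))%R.
pose F (t : R) : R := (- (1 - a)^-1 * (1 - t) `^ (1 - a))%R.
have Fd (t : R) : (t < 1)%R -> is_derive t 1%R F (f t).
  move=> t1; have t10 : (0 < 1 - t)%R by rewrite subr_gt0.
  have D1 : is_derive t 1%R (fun t => 1 - t)%R (- 1)%R by exact: is_derive_one_minus.
  have D2 := @is_derive1_comp R (fun x : R => x `^ (1 - a))%R _ t _ _
    (is_derive1_powR (1 - a) t10) D1.
  apply: (is_derive_congr (is_deriveZ (- (1 - a)^-1)%R D2)) => //.
  rewrite /f (_ : 1 - a - 1 = - a)%R; last by ring.
  by rewrite /GRing.scale /=; field; rewrite gt_eqF.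
have fc (t : R) : (t < 1)%R -> {for t, continuous f}.
  move=> t1; have t10 : (0 < 1 - t)%R by rewrite subr_gt0.
  have D1 : is_derive t 1%R (fun t => 1 - t)%R (- 1)%R by exact: is_derive_one_minus.
  have D2 := @is_derive1_comp R (fun x : R => x `^ (- a))%R _ t _ _
    (is_derive1_powR (- a) t10) D1.
  exact: is_derive_continuous D2.
pose b n : R := (1 - n.+2%:R^-1)%R.
have b1 n : (b n < 1)%R by rewrite ltrBlDr ltrDl invr_gt0.
have b0 n : (0 < b n)%R.
  by rewrite subr_gt0 invf_lt1// ltr1n.
have -> : [set` `[0%R, 1%R[] = \bigcup_n [set` `[0%R, b n]].
  apply/seteqP; split=> t /=; rewrite in_itv/=.
    move=> /andP[t0 t1]; have t10 : (0 < 1 - t)%R by rewrite subr_gt0.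
    have [n _ /(_ n (leqnn _)) nt] := near_infty_natSinv_lt (PosNum t10).
    exists n => //=; rewrite in_itv/= t0 /= lerBrDr -lerBrDl.
    rewrite (le_trans _ (ltW nt))// lef_pV2 ?posrE ?ltr0n// ler_nat.
    exact: leqnSn.
  move=> [n _ /=]; rewrite in_itv/= => /andP[-> tb] /=.
  exact: le_lt_trans (b1 n).
have mf n : measurable_fun [set` `[0%R, b n]] (EFin \o f).
  apply/measurable_EFinP; apply: measurable_funTS.
  apply: (@measurableT_comp _ _ _ _ _ _ (fun x : R => x `^ (- a))%R).
    exact: measurable_powR.
  exact: measurable_funB.
have nd : nondecreasing_seq (fun n => [set` `[0%R, b n]] : set R).
  move=> i k ik; rewrite subsetEset => t /=; rewrite !in_itv/= => /andP[-> tn] /=.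
  by rewrite (le_trans tn)// lerB// lef_pV2 ?posrE ?ltr0n// ler_nat.
have f0 k (t : R) : [set` `[0%R, b k]] t -> 0 <= (EFin \o f) t.
  by move=> _; rewrite lee_fin powR_ge0.
have cv := @ge0_nondecreasing_set_cvg_integral _ (measurableTypeR R) R _ (EFin \o f) leb nd
  (fun n => measurable_itv _) mf f0.
rewrite -(cvg_lim _ cv)//; apply: lime_le; first by apply/cvg_ex; eexists; exact: cv.
apply: nearW => n /=.
rewrite (@continuous_FTC2 R f F 0 (b n)) ?b0//.
- rewrite -EFinB lee_fin /F subr0 powR1 mulr1 opprK mulNr.
  by rewrite gerDr oppr_le0 mulr_ge0 ?powR_ge0// invr_ge0 ltW.
- move=> t; apply: continuous_in_subspaceT => {}t; rewrite inE/= in_itv/= => /andP[_ tb].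
  by apply: fc; exact: le_lt_trans (b1 n).
- split.
  + move=> t; rewrite in_itv/= => /andP[_ tb].
    by have [] := Fd t (lt_trans tb (b1 n)).
  + by apply: cvg_at_right_filter; exact: is_derive_continuous (Fd 0%R ltr01).
  + by apply: cvg_at_left_filter; exact: is_derive_continuous (Fd _ (b1 n)).
- move=> t; rewrite in_itv/= => /andP[_ tb]; rewrite derive1E.
  by have [_ ->] := Fd t (lt_trans tb (b1 n)).
Qed.

Lemma lam_powR (t a : R) : (0 <= t < 1)%R ->
  (lam t `^ a = (1 - t) `^ (- (a / 2)))%R.
Proof.
move=> /andP[_ t1]; have t10 : (0 <= 1 - t)%R by rewrite subr_ge0 ltW.
rewrite /lam -powR12_sqrt// -[(_ `^ _)^-1%R]powR_inv1 ?powR_ge0// -!powRrM; congr (_ `^ _)%R.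
by field.
Qed.

(** lam^a = (1 - t)^(-a/2) has a finite L^r norm when a r / 2 < 1; the case a = 0
is the one needed for r = +oo. *)
Lemma Lr_lty (r : \bar R) (F : measurableTypeR R -> \bar R) (K a : R) :
  1 <= r -> measurable_fun setT F -> (0 <= K)%R -> (0 <= a)%R ->
  (a < 2 * fine r^-1 \/ a = 0)%R ->
  (forall t, (0 <= t < 1)%R -> 0 <= F t <= (K * lam t `^ a)%:E) ->
  Lnorm (@lebesgue01 R) r F < +oo.
Proof.
move=> r1 mF K0 a0 ar HF.
pose D : set (measurableTypeR R) := [set` `[0%R, 1%R[].
have mD : measurable D by exact: measurable_itv.
have nuD : @lebesgue01 R (~` D) = 0.
  by rewrite /lebesgue01 /mrestr /= setICl measure0.
rewrite unlock; case: r r1 ar => [r| |]; last by rewrite leNgt ltNye.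
- rewrite lee_fin => r1 ar; have r0 : (0 < r)%R by rewrite (lt_le_trans ltr01).
  have mFr : measurable_fun setT (fun t => `|F t| `^ r).
    by apply: (measurableT_comp (measurable_poweR r)); exact: measurableT_comp.
  apply: poweR_lty.
  rewrite (@ge0_negligible_integral _ _ _ _ setT (~` D)) //; last 2 first.
  + exact: measurableC.
  + by move=> t _; exact: poweR_ge0.
  rewrite setTD setCK.
  rewrite (@eq_measure_integral _ _ _ D leb); last first.
    by move=> A mA AD; rewrite /lebesgue01 /mrestr; congr (lebesgue_measure _); exact: setIidl.
  pose e : R := (a * r / 2)%R.
  have e0 : (0 <= e)%R by rewrite divr_ge0// mulr_ge0// ltW.
  have e1 : (e < 1)%R.
    case: ar => [|aE]; last by rewrite /e aE !mul0r ltr01.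
    rewrite inver (negbTE (lt0r_neq0 r0)) /= => ar.
    rewrite /e ltr_pdivrMr// mul1r -ltr_pdivlMr//.
  apply: (@le_lt_trans _ _ (\int[leb]_(t in D)
      ((K `^ r)%:E * ((1 - t) `^ (- e))%:E))).
    have mB : measurable_fun D (fun t : R => ((1 - t) `^ (- e))%:E).
      apply/measurable_EFinP; apply: measurable_funTS.
      apply: (@measurableT_comp _ _ _ _ _ _ (fun x : R => x `^ (- e))%R).
        exact: measurable_powR.
      exact: measurable_funB.
    apply: ge0_le_integral => //.
    + by move=> t _; exact: poweR_ge0.
    + exact: measurable_funTS.
    + exact: measurable_funeM.
    + move=> t; rewrite {1}/D /= in_itv/= => t01; have /andP[F0 FK] := HF t t01.
      rewrite gee0_abs// -EFinM.
      have -> : (K `^ r * (1 - t) `^ (- e))%:E = (K * lam t `^ a)%:E `^ r.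
        rewrite poweR_EFin powRM ?powR_ge0// lam_powR// -powRrM; congr (_ * _ `^ _)%:E.
        by rewrite /e; field.
      apply: gt0_ler_poweR => //.
      * exact: ltW.
      * by rewrite in_itv/= F0 leey.
      * by rewrite in_itv/= lee_fin mulr_ge0 ?powR_ge0// leey.
  rewrite ge0_integralZl//.
  + apply: (@le_lt_trans _ _ ((K `^ r)%:E * ((1 - e)^-1)%:E)).
      by rewrite lee_wpmul2l ?lee_fin ?powR_ge0//; exact: integral_onem_powR.
    by rewrite -EFinM ltry.
  + apply/measurable_EFinP; apply: measurable_funTS.
    apply: (@measurableT_comp _ _ _ _ _ _ (fun x : R => x `^ (- e))%R).
      exact: measurable_powR.
    exact: measurable_funB.
  + by move=> t _; rewrite lee_fin powR_ge0.
  + by rewrite lee_fin powR_ge0.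
move=> _; rewrite invey /= mulr0 => ar.
have {}ar : a = 0%R by case: ar => // ar; lra.
case: ifPn => _; last by rewrite ltry.
apply: (@le_lt_trans _ _ K%:E); last by rewrite ltry.
apply/ess_supP; exists (~` D); split=> //; first exact: measurableC.
move=> t /= /negP; rewrite -ltNge => H Dt.
move: H; rewrite ltNge => /negP; apply.
move: Dt; rewrite /D /= in_itv/= => t01; have /andP[F0 FK] := HF t t01.
by rewrite gee0_abs// (le_trans FK)// ar powRr0 mulr1.
Qed.

End time_integrability.

(** The hypothesis says that the exponent 1 + d/(m+1) - d/q of lam is less than
2/r; a negative exponent is replaced by 0. *)
Lemma drift_in_LrLq (R : realType) (d m : nat) (r q : \bar R) :
  (1 <= r)%E -> (1 <= q)%E ->
  1 + d%:R / m.+1%:R < d%:R * fine q^-1 + 2 * fine r^-1 ->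
  in_LrLq r q (@drift R m.+1 d).
Proof.
move=> r1 q1 H; have mL := @measurable_Lq_drift R d m q q1.
split.
- by apply: measurable_funTS; exact: (measurable_drift (ltn0Sn m) (d := d)).
- exact: measurable_funTS.
have [K K0 HK] := Lq_drift_le d m q1.
pose b := 1 + d%:R / m.+1%:R - d%:R * fine q^-1.
have ir0 : 0 <= fine r^-1 by rewrite fine_ge0// inve_ge0 (le_trans _ r1)// lee01.
apply: (@Lr_lty R r _ K (Num.max b 0)) => //.
- by rewrite le_max lexx orbT.
- have [b0|b0] := lerP b 0; first by right.
  by left; rewrite /b ltrBlDl.
move=> t t01; rewrite Lnorm_ge0/= (le_trans (HK t t01))// lee_fin ler_wpM2l//.
by rewrite ler_powR ?lam_ge1// le_max lexx.
Qed.

Lemma fine_inve (R : realType) (q : \bar R) : (1 <= q)%E ->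
  (q^-1)%E = (fine q^-1)%:E.
Proof.
case: q => [q| |]; last by rewrite leNgt ltNye.
  rewrite lee_fin => q1; rewrite inver gt_eqF//.
  exact: lt_le_trans ltr01 q1.
by rewrite invey.
Qed.

(** * The theorem *)

Theorem theorem4p1 (R : realType) (d : nat) (r q : \bar R)
    (hd : (1 <= d)%N) (hr : (1 <= r)%E) (hq : (1 <= q)%E)
    (hrq : (1 < (d%:R)%:E / q + 2%:E / r)%E) :
  exists (b : R -> 'rV[R]_d -> 'rV[R]_d) (u0 : 'rV[R]_d -> R)
         (u : R -> 'rV[R]_d -> R),
    [/\ in_LrLq r q b,
        smooth_on (@time_space R d) (fun z => b z.1 z.2),
        smooth_compact_support u0,
        smooth_on (@time_space R d) (fun z => u z.1 z.2)
      & [/\ cauchy_problem b u u0,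
            ~ equi_integrable `[0, 1[ u
          & forall p : \bar R, (1 < p)%E ->
              Lnorm (lebesgue_rV R d) p (EFin \o u t) @[t --> (1 : R)^'-]
                --> +oo%E]].
Proof.
pose g := d%:R * fine q^-1 + 2 * fine r^-1 - 1 : R.
have g0 : 0 < g.
  move: hrq; rewrite (fine_inve hq) (fine_inve hr) -!EFinM -EFinD lte_fin.
  by rewrite subr_gt0.
have gd0 : 0 < g / (d%:R + 1) by rewrite divr_gt0// ltr_wpDl.
(* m is such that d / (m + 1) is less than the gap g in the assumption. *)
have [m _ /(_ m (leqnn _)) /= mg] := near_infty_natSinv_lt (PosNum gd0).
have dm : 1 + d%:R / m.+1%:R < d%:R * fine q^-1 + 2 * fine r^-1.
  have : d%:R / m.+1%:R < g.
    apply: (@le_lt_trans _ _ ((d%:R + 1) / m.+1%:R)).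
      by rewrite ler_wpM2r// lerDl.
    by rewrite mulrC -ltr_pdivlMr// ltr_wpDl.
  by rewrite /g ltrBrDl.
exists (@drift R m.+1 d), (@density R m.+1 d 0), (@density R m.+1 d); split.
- exact: drift_in_LrLq.
- exact: drift_smooth.
- exact: initial_smooth_compact_support.
- exact: density_smooth.
split.
- exact: density_cauchy.
- exact: density_not_equi_integrable.
- by move=> p p1; exact: density_Lnorm_cvgy.
Qed.
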